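(* Let $d\ge 2$ and let $\Omega\subset\mathbb{R}^d$ be a bounded connected Lipschitz domain such that $\mathsf{J}_l(\Omega)=\Omega$ for all $l\in\{2,\dots,d\}$, where $\mathsf{J}_l\colon\mathbb{R}^d\to\mathbb{R}^d$ is the reflection $\mathsf{J}_l(x_1,\dots,x_l,\dots,x_d):=(x_1,\dots,-x_l,\dots,x_d)$ which changes the sign of the $l$-th coordinate. Let $\{\lambda_k\}_{k\ge 1}$ and $\{\mu_k\}_{k\ge 1}$ be the eigenvalues of the Dirichlet biharmonic operator $\mathsf{H}_{\rm D}$ and of the Neumann biharmonic operator $\mathsf{H}_{\rm N}$ on $\Omega$, respectively, each enumerated in non-decreasing order and repeated with multiplicities taken into account. Then $$\mu_{k+d+1}\le \lambda_k\qquad\text{for all } k\in\mathbb{N}.$$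
   Context: Here $\mathbb{N}=\{1,2,3,\dots\}$. $H^2(\Omega)$ is the $L^2$-based second-order Sobolev space on $\Omega$, $H^2_0(\Omega)$ is the closure of $C_0^\infty(\Omega)$ in $H^2(\Omega)$, and $\partial_{ij}u:=\frac{\partial^2 u}{\partial x_i\partial x_j}$ for $i,j\in\{1,\dots,d\}$. Define the quadratic forms $$\mathfrak{h}_{\rm D}[u]:=\sum_{i,j=1}^d\|\partial_{ij}u\|^2_{L^2(\Omega)},\quad \mathrm{dom}\,\mathfrak{h}_{\rm D}:=H^2_0(\Omega),$$ $$\mathfrak{h}_{\rm N}[u]:=\sum_{i,j=1}^d\|\partial_{ij}u\|^2_{L^2(\Omega)},\quad \mathrm{dom}\,\mathfrak{h}_{\rm N}:=H^2(\Omega).$$ Both forms are non-negative, densely defined and closed in the Hilbert space $L^2(\Omega)$. The Dirichlet and Neumann biharmonic operators $\mathsf{H}_{\rm D}$ and $\mathsf{H}_{\rm N}$ on $\Omega$ are the self-adjoint operators in $L^2(\Omega)$ associated with $\mathfrak{h}_{\rm D}$ and $\mathfrak{h}_{\rm N}$, respectively, via the first representation theorem. Their spectra are purely discrete. By the min-max principle their eigenvalues are characterised, for $k\in\mathbb{N}$, by $$\lambda_k=\inf_{\substack{\mathcal{L}\subset H^2_0(\Omega)\\ \dim\mathcal{L}=k}}\ \sup_{u\in\mathcal{L}\setminus\{0\}}\frac{\sum_{i,j=1}^d\|\partial_{ij}u\|^2_{L^2(\Omega)}}{\|u\|^2_{L^2(\Omega)}},\qquad \mu_k=\inf_{\substack{\mathcal{L}\subset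 H^2(\Omega)\\ \dim\mathcal{L}=k}}\ \sup_{u\in\mathcal{L}\setminus\{0\}}\frac{\sum_{i,j=1}^d\|\partial_{ij}u\|^2_{L^2(\Omega)}}{\|u\|^2_{L^2(\Omega)}},$$ where the infima are over $k$-dimensional linear subspaces. *)

(* Defs.v *)
From HB Require Import structures.
From mathcomp Require Import all_boot all_order all_algebra.
From mathcomp Require Import all_classical all_reals all_analysis.
Import Order.TTheory GRing.Theory Num.Theory numFieldNormedType.Exports.

Set Implicit Arguments.
Unset Strict Implicit.
Unset Printing Implicit Defensive.

Local Open Scope classical_set_scope.
Local Open Scope ring_scope.

(* R^d is 'rV[R]_d, normed by the library with the sup norm, which is equivalent
   to the Euclidean one; coordinates are numbered 0, ..., d-1. *)

Definition rV_display : measure_display. Proof. exact: default_measure_display. Qed.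

Definition rV_coord (R : realType) (n : nat) (i : 'I_n) (x : 'rV[R]_n) :
  R := x ord0 i.

Section rV_measurable.
Context (R : realType) (n : nat).

Let rV_set0 : g_sigma_preimage (@rV_coord R n) set0.
Proof. exact: sigma_algebra0. Qed.

Let rV_setC A : g_sigma_preimage (@rV_coord R n) A ->
  g_sigma_preimage (@rV_coord R n) (~` A).
Proof. exact: sigma_algebraC. Qed.

Let rV_bigcup (F : (set 'rV[R]_n)^nat) :
  (forall i, g_sigma_preimage (@rV_coord R n) (F i)) ->
  g_sigma_preimage (@rV_coord R n) (\bigcup_i (F i)).
Proof. exact: sigma_algebra_bigcup. Qed.

(* The product sigma-algebra, which on R^n is the Borel one. *)
HB.instance Definition _ := @isMeasurable.Build rV_display
  'rV[R]_n (g_sigma_preimage (@rV_coord R n)) rV_set0 rV_setC rV_bigcup.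

End rV_measurable.

Lemma measurable_rV_coord (R : realType) (n : nat) (i : 'I_n) :
  measurable_fun [set: 'rV[R]_n] (@rV_coord R n i).
Proof.
move=> _ Y mY; rewrite setTI; apply: sub_sigma_algebra => /=.
rewrite -bigcup_seq/=; exists i => /=; first by rewrite mem_index_enum.
by exists Y => //; rewrite setTI.
Qed.

Lemma measurable_rVP (R : realType) (n : nat) d (T : measurableType d)
    (f : T -> 'rV[R]_n) :
  (forall i, measurable_fun [set: T] (@rV_coord R n i \o f)) ->
  measurable_fun [set: T] f.
Proof.
move=> mf _ A mA; rewrite setTI.
have : (preimage_set_system setT f (g_sigma_preimage (@rV_coord R n)))
    (f @^-1` A) by exists A => //; rewrite setTI.
rewrite -(@g_sigma_preimage_comp _ _ n _ (@rV_coord R n) _ f).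
apply: smallest_sub; first exact: sigma_algebra_measurable.
move=> B; rewrite -bigcup_seq/= => -[i _ [C mC <-]].
exact: mf.
Qed.

Definition rV_cons (R : realType) (n : nat) (p : measurableTypeR R * 'rV[R]_n) :
  'rV[R]_n.+1 := \row_i if unlift ord0 i is Some j then p.2 ord0 j else p.1.

Definition rV_uncons (R : realType) (n : nat) (x : 'rV[R]_n.+1) :
  measurableTypeR R * 'rV[R]_n := (x ord0 ord0, \row_j x ord0 (lift ord0 j)).

Lemma rV_consK (R : realType) (n : nat) : cancel (@rV_cons R n) (@rV_uncons R n).
Proof.
move=> [t v]; rewrite /rV_uncons /rV_cons !mxE unlift_none; congr pair.
by apply/rowP => j; rewrite !mxE liftK.
Qed.

Lemma rV_unconsK (R : realType) (n : nat) : cancel (@rV_uncons R n) (@rV_cons R n).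
Proof.
move=> x; apply/rowP => i; rewrite !mxE.
by case: unliftP => [j|] ->//=; rewrite mxE.
Qed.

Lemma measurable_rV_cons (R : realType) (n : nat) :
  measurable_fun [set: measurableTypeR R * 'rV[R]_n] (@rV_cons R n).
Proof.
apply: measurable_rVP => i; case: (unliftP ord0 i) => [j ->|->].
- rewrite (_ : _ \o _ = @rV_coord R n j \o snd); last first.
    by apply/funext => p; rewrite /rV_coord /rV_cons /= mxE liftK.
  by apply: measurableT_comp => //; exact: measurable_rV_coord.
- rewrite (_ : _ \o _ = fst) //.
  by apply/funext => p; rewrite /rV_coord /rV_cons /= mxE unlift_none.
Qed.

Lemma measurable_rV_uncons (R : realType) (n : nat) :
  measurable_fun [set: 'rV[R]_n.+1] (@rV_uncons R n).
Proof.
apply: measurable_fun_pair; first exact: (measurable_rV_coord ord0).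
apply: measurable_rVP => j.
rewrite (_ : _ \o _ = @rV_coord R n.+1 (lift ord0 j)).
  exact: measurable_rV_coord.
by apply/funext => x; rewrite /rV_coord /= mxE.
Qed.

Section lebesgue_rV_step.
Context (R : realType) (n : nat).
Variable m : {sigma_finite_measure set 'rV[R]_n -> \bar R}.

Definition lebesgue_rV_step : set 'rV[R]_n.+1 -> \bar R :=
  pushforward (@lebesgue_measure R \x m)%E (@rV_cons R n).

Let step0 : lebesgue_rV_step set0 = 0%E.
Proof. by rewrite /lebesgue_rV_step /pushforward preimage_set0 measure0. Qed.

Let step_ge0 A : (0 <= lebesgue_rV_step A)%E.
Proof. exact: (measure_ge0 (@lebesgue_measure R \x m)%E). Qed.

Let step_sigma_additive : semi_sigma_additive lebesgue_rV_step.
Proof.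
have mc A : measurable A -> measurable (@rV_cons R n @^-1` A).
  by move=> mA; rewrite -[X in measurable X]setTI; exact: measurable_rV_cons.
move=> F mF tF mUF; rewrite /lebesgue_rV_step /pushforward preimage_bigcup.
apply: measure_semi_sigma_additive => [k|| ].
- exact: mc.
- apply/trivIsetP => /= i j _ _ ij; rewrite -preimage_setI.
  by move/trivIsetP : tF => /(_ _ _ _ _ ij) ->//; rewrite preimage_set0.
- by rewrite -preimage_bigcup; exact: mc.
Qed.

HB.instance Definition _ := isMeasure.Build _ _ _ lebesgue_rV_step
  step0 step_ge0 step_sigma_additive.

Let step_sigma_finite : sigma_finite setT lebesgue_rV_step.
Proof.
pose leb : {sigma_finite_measure set (measurableTypeR R) -> \bar R} :=
  @lebesgue_measure R.
have /sigma_finiteP[F [TF ndF Foo]] := sigma_finiteT leb.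
have /sigma_finiteP[G [TG ndG Goo]] := sigma_finiteT m.
exists (fun k => @rV_uncons R n @^-1` (F k `*` G k)).
  apply/esym; rewrite -subTset => x _.
  have [i _ Fi] : (\bigcup_i F i) (rV_uncons x).1 by rewrite -TF.
  have [j _ Gj] : (\bigcup_i G i) (rV_uncons x).2 by rewrite -TG.
  exists (maxn i j) => //; split.
  - by move: Fi; exact/subsetPset/ndF/leq_maxl.
  - by move: Gj; exact/subsetPset/ndG/leq_maxr.
move=> k; have [mF Fk] := Foo k; have [mG Gk] := Goo k; split.
  rewrite -[X in measurable X]setTI.
  by apply: measurable_rV_uncons => //; exact: measurableX.
rewrite /lebesgue_rV_step /pushforward -comp_preimage.
rewrite (_ : _ \o _ = id) ?preimage_id; last first.
  by apply/funext => p /=; rewrite rV_consK.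
by rewrite product_measure1E// lte_mul_pinfty// ge0_fin_numE.
Qed.

HB.instance Definition _ := Measure_isSigmaFinite.Build _ _ _ lebesgue_rV_step
  step_sigma_finite.

End lebesgue_rV_step.

(* Lebesgue measure: a point mass on R^0, and lebesgue_measure on R times the
   measure of R^n on R^n.+1, the first coordinate being the factor R. *)
Fixpoint lebesgue_rV (R : realType) (n : nat) :
    {sigma_finite_measure set 'rV[R]_n -> \bar R} :=
  if n is n'.+1 then lebesgue_rV_step (lebesgue_rV R n')
  else dirac (0 : 'rV[R]_0).

(* Functions on Omega are total functions on R^d of which only the values on
   Omega matter; elements of L^2 are representatives of their classes. *)

Section L2.
Context (R : realType) (d : nat) (Omega : set 'rV[R]_d).
Implicit Types u v : 'rV[R]_d -> R.

Definition L2 : set ('rV[R]_d -> R) := [set u : 'rV[R]_d -> R |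
  measurable_fun Omega u /\
  (lebesgue_rV R d).-integrable Omega (fun x => (u x ^+ 2)%:E)].

Definition L2_dot u v : R :=
  (\int[lebesgue_rV R d]_(x in Omega) (u x * v x))%R.

Definition L2_sqnorm u : R := L2_dot u u.

End L2.

Definition iter_partial (R : realType) (d : nat) (s : seq 'I_d)
  (phi : 'rV[R]_d -> R) : 'rV[R]_d -> R :=
  foldr (fun i f => 'D_(delta_mx 0 i) f) phi s.

Definition smooth (R : realType) (d : nat) (phi : 'rV[R]_d -> R) : Prop :=
  forall s : seq 'I_d, continuous (iter_partial s phi) /\
    forall (i : 'I_d) (x : 'rV[R]_d),
      derivable (iter_partial s phi) x (delta_mx 0 i).

Section Sobolev.
Context (R : realType) (d : nat) (Omega : set 'rV[R]_d).
Implicit Types (u v g phi : 'rV[R]_d -> R) (s : seq 'I_d).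

(* C_0^oo(Omega), extended by zero to R^d. *)
Definition test_function : set ('rV[R]_d -> R) := [set phi |
  smooth phi /\
  exists2 K, compact K /\ K `<=` Omega & forall x, ~ K x -> phi x = 0].

Definition is_weak_partial s u g : Prop :=
  forall phi, test_function phi ->
    L2_dot Omega u (iter_partial s phi) = (-1) ^+ size s * L2_dot Omega g phi.

Definition weak_partials_in_L2 s u : set ('rV[R]_d -> R) :=
  [set g | L2 Omega g /\ is_weak_partial s u g].

(* The weak derivative (unique up to a.e. equality on Omega) when it exists in
   L^2(Omega), and 0 otherwise. *)
Definition weak_partial s u : 'rV[R]_d -> R :=
  xget (fun=> 0) (weak_partials_in_L2 s u).

Definition H2 : set ('rV[R]_d -> R) := [set u | L2 Omega u /\
  forall s, (size s <= 2)%N -> exists g, weak_partials_in_L2 s u g].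

Definition H2_sqnorm u : R :=
  L2_sqnorm Omega u
  + \sum_(i < d) L2_sqnorm Omega (weak_partial [:: i] u)
  + \sum_(i < d) \sum_(j < d) L2_sqnorm Omega (weak_partial [:: i; j] u).

Definition H20 : set ('rV[R]_d -> R) := [set u | H2 u /\
  forall eps : R, 0 < eps ->
    exists2 phi, test_function phi & H2_sqnorm (u - phi) < eps].

(* h[u, v], with h[u, u] = \sum_(i, j) ||d_ij u||^2; the forms h_D and h_N are
   its restrictions to H20 and H2. *)
Definition hessian_form u v : R :=
  \sum_(i < d) \sum_(j < d)
    L2_dot Omega (weak_partial [:: i; j] u) (weak_partial [:: i; j] v).

(* Operators in L^2(Omega) are represented by their graphs. By the first
   representation theorem, the operator of the form hessian_form with domain V
   maps u to f iff u \in V and h[u, v] = (f, v) for all v \in V. *)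
Definition form_operator (V : set ('rV[R]_d -> R))
    (u f : 'rV[R]_d -> R) : Prop :=
  [/\ V u, L2 Omega f & forall v, V v -> hessian_form u v = L2_dot Omega f v].

Definition dirichlet_biharmonic := form_operator H20.

Definition neumann_biharmonic := form_operator H2.

(* lam is the sequence lam_0 <= lam_1 <= ... of all eigenvalues of an operator T
   with purely discrete spectrum, with multiplicities: T u = lam n u has the
   orthonormal solutions e n, and these form an orthonormal basis of
   L^2(Omega), so that the eigenspace of each t has the basis
   {e n | lam n = t}, which is finite since lam tends to +oo. *)
Definition eigenvalue_sequence
    (T : ('rV[R]_d -> R) -> ('rV[R]_d -> R) -> Prop) (lam : nat -> R) : Prop :=
  [/\ nondecreasing_seq lam, lam @ \oo --> +oo &
    exists e : nat -> 'rV[R]_d -> R,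
    [/\ forall n, T (e n) (lam n *: e n),
      forall m n, L2_dot Omega (e m) (e n) = (m == n)%:R &
      forall u, L2 Omega u ->
        L2_sqnorm Omega (u - \sum_(k < n) L2_dot Omega u (e k) *: e k)
          @[n --> \oo] --> (0 : R)]].

End Sobolev.

(* Near each boundary point, in suitable orthonormal coordinates, Omega is the
   set of points above the graph of a Lipschitz function of d - 1 variables. *)
Definition lipschitz_boundary (R : realType) (d : nat) (Omega : set 'rV[R]_d) :
    Prop :=
  forall p, (closure Omega `\` Omega°) p ->
  exists (Q : 'M[R]_d) (l : 'I_d) (gamma : 'rV[R]_d.-1 -> R) (r : R),
  [/\ Q *m Q^T = 1%:M, [lipschitz gamma x | x in setT], 0 < r &
    forall x, ball p r x ->
      (Omega x <-> gamma (col' l (x *m Q)) < (x *m Q) ord0 l)].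

Definition bounded_lipschitz_domain (R : realType) (d : nat)
    (Omega : set 'rV[R]_d) : Prop :=
  [/\ open Omega, Omega !=set0, connected Omega, bounded_set Omega &
    lipschitz_boundary Omega].

Definition reflection (R : realType) (d : nat) (l : 'I_d) (x : 'rV[R]_d) :
    'rV[R]_d :=
  \row_(j < d) (if j == l then - x ord0 j else x ord0 j).

(* Main.v *)
Require Import Defs.
From HB Require Import structures.
From mathcomp Require Import all_boot all_order all_algebra.
From mathcomp Require Import all_classical all_reals all_analysis.
From mathcomp Require Import measurable_realfun.
From mathcomp Require Import ring lra.
Import Order.TTheory GRing.Theory Num.Theory numFieldNormedType.Exports.

(** The proof is by comparison of Rayleigh quotients on one trial space, in the manner
of Filonov. Let h[u] be the sum of the |d_ij u|^2, let lambda be the k-th Dirichlet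
eigenvalue (counted from 0) and K = lambda^(1/4); here lambda > 0. The trial
functions are w = u + V, where u is a combination of the Dirichlet eigenfunctions
e_0, ..., e_k and V is a combination of the d + 1 functions cos (K x_1) and
sin (K x_1), ..., sin (K x_d). They depend on k + d + 2 coefficients, so some nonzero
choice of these makes w orthogonal to the first k + d + 1 Neumann eigenfunctions,
and then mu_(k+d+1) |w|^2 <= h[w] ([neumann_lower_bound]). On the other hand
h[w] <= lambda |w|^2, because h[u] <= lambda |u|^2 and

- h[u, V] = lambda (u, V) for u in H^2_0: a wave in the single variable x_i has
  d_ii = - K^2 as its only second derivative, so V solves the eigenvalue equation
  and integration by parts leaves no boundary term ([approximable_wave_hess]);

- h[V] = lambda |V|^2: the reflection of x_l, for l other than the first index,
  changes the sign of sin (K x_l) only, so waves in different coordinates are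
  orthogonal and both sides split over the coordinates ([separated_wave_hess]).
  This is where the symmetry of Omega enters, and why only x_1 carries a cosine.

It remains to see that |w| is not 0. As d >= 2, V has the vanishing mixed derivative
d_12 V, whereas |u| <= C |d_12 u| on H^2_0 by Poincare's inequality. Hence w = 0
forces u = 0, then V = 0, and all coefficients vanish ([approximable_null],
[separated_wave_null]). The same inequality shows that lambda > 0.

The analysis behind these steps is elementary. Lebesgue measure is invariant under
translations, which gives integration by parts against test functions, and under
reflections. Weak derivatives are unique up to null functions since test functions
approximate the indicators of boxes ([orthogonal_test_null]), which makes the
Hessian form bilinear. *)

Set Implicit Arguments.
Unset Strict Implicit.
Unset Printing Implicit Defensive.

Local Open Scope classical_set_scope.
Local Open Scope ring_scope.

(** * Smooth functions on R^d *)

Section smooth_functions.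
Context (R : realType) (d : nat).
Implicit Types (f g : 'rV[R]_d -> R) (i : 'I_d) (x : 'rV[R]_d).

Local Notation e_ i := (delta_mx 0 i : 'rV[R]_d).

(** Smoothness is the largest regularity class stable under partial derivatives;
this is how all smooth functions below are recognised. *)
Lemma smooth_coinduction (S : set ('rV[R]_d -> R)) :
  (forall f, S f -> continuous f /\ forall i x, derivable f x (e_ i)) ->
  (forall f i, S f -> S ('D_(e_ i) f)) -> forall f, S f -> smooth f.
Proof.
move=> Sc SD f Sf s; apply: Sc; elim: s => //= i s IHs; exact: SD.
Qed.

Lemma iter_partial_rcons s i f :
  iter_partial (rcons s i) f = iter_partial s ('D_(e_ i) f).
Proof. by rewrite /iter_partial foldr_rcons. Qed.

Lemma smooth_continuous f x : smooth f -> {for x, continuous f}.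
Proof. move=> sf; exact: (sf [::]).1. Qed.

Lemma smooth_derivable f i x : smooth f -> derivable f x (e_ i).
Proof. move=> sf; exact: (sf [::]).2. Qed.

Lemma smooth_partial f i : smooth f -> smooth ('D_(e_ i) f).
Proof. move=> sf s; rewrite -iter_partial_rcons; exact: sf. Qed.

Lemma smooth_iter_partial f s : smooth f -> smooth (iter_partial s f).
Proof. move=> sf; elim: s => [|i s IHs]; [exact: sf|exact: smooth_partial]. Qed.

Lemma partialD f g i : smooth f -> smooth g ->
  'D_(e_ i) (f \+ g) = 'D_(e_ i) f \+ 'D_(e_ i) g.
Proof.
move=> sf sg; apply/funext => x.
exact: (deriveD (smooth_derivable sf) (smooth_derivable sg)).
Qed.

Lemma partialZ f i c : smooth f ->
  'D_(e_ i) (c \*o f) = c \*o 'D_(e_ i) f.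
Proof.
by move=> sf; apply/funext => x; exact: (deriveZ c (smooth_derivable sf)).
Qed.

Lemma partialM f g i : smooth f -> smooth g ->
  'D_(e_ i) (f \* g) = 'D_(e_ i) f \* g \+ f \* 'D_(e_ i) g.
Proof.
move=> sf sg; apply/funext => x.
have E : 'D_(e_ i) (f \* g) x = f x * 'D_(e_ i) g x + g x * 'D_(e_ i) f x.
  exact: (deriveM (smooth_derivable sf) (smooth_derivable sg)).
by rewrite [LHS]E /= addrC [g x * _]mulrC.
Qed.

Lemma smooth_cst (c : R) : smooth (cst c : 'rV[R]_d -> R).
Proof.
apply: (@smooth_coinduction [set f | exists c : R, f = cst c] _ _ (cst c)); last by exists c.
- move=> _ [a ->]; split=> [x|i x]; first exact: cst_continuous.
  exact: (@derivable_cst R 'rV[R]_d R a x (e_ i)).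
- move=> _ i [a ->]; exists 0; apply/funext => x; exact: derive_cst.
Qed.

Lemma smoothD f g : smooth f -> smooth g -> smooth (f \+ g).
Proof.
move=> sf sg.
apply: (@smooth_coinduction
  [set h | exists f g, [/\ smooth f, smooth g & h = f \+ g]] _ _ (f \+ g)); last by exists f, g; split.
- move=> _ [{sf sg}f [{}g [sf sg ->]]]; split=> [x|i x].
    exact: (continuousD (smooth_continuous sf) (smooth_continuous sg)).
  exact: (derivableD (smooth_derivable sf) (smooth_derivable sg)).
- move=> _ i [{sf sg}f [{}g [sf sg ->]]]; rewrite partialD//.
  exists ('D_(e_ i) f), ('D_(e_ i) g); split; [exact: smooth_partial..|by []].
Qed.

Lemma smooth_sum (I : Type) (r : seq I) (F : I -> 'rV[R]_d -> R) :
  (forall j, smooth (F j)) -> smooth (fun x => \sum_(j <- r) F j x).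
Proof.
move=> sF; elim: r => [|j r IHr].
  rewrite (_ : (fun _ => _) = cst 0); first exact: smooth_cst.
  by apply/funext => x; rewrite big_nil.
rewrite (_ : (fun _ => _) = F j \+ (fun x => \sum_(j <- r) F j x)).
  exact (smoothD (sF j) IHr).
by apply/funext => x; rewrite big_cons.
Qed.

(** By the Leibniz rule the finite sums of products of smooth functions are stable
under partial derivatives, unlike the products themselves. *)
Inductive sum_of_products : ('rV[R]_d -> R) -> Prop :=
| SumOne f g : smooth f -> smooth g -> sum_of_products (f \* g)
| SumAdd f g : sum_of_products f -> sum_of_products g -> sum_of_products (f \+ g).

Lemma smoothM f g : smooth f -> smooth g -> smooth (f \* g).
Proof.
have reg h : sum_of_products h -> continuous h /\ forall i x, derivable h x (e_ i).
  elim=> {h}[{}f {}g sf sg|{}f {}g _ [cf df] _ [cg dg]]; split=> [x|i x].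
  - exact: (continuousM (smooth_continuous sf) (smooth_continuous sg)).
  - exact: (derivableM (smooth_derivable sf) (smooth_derivable sg)).
  - exact: (continuousD (cf x) (cg x)).
  - exact: (derivableD (df i x) (dg i x)).
move=> sf sg; apply: (@smooth_coinduction sum_of_products _ _ (f \* g)); last exact: SumOne.
- exact: reg.
- move=> h i; elim=> {h}[{sf sg}f {}g sf sg|{sf sg}f {}g hf IHf hg IHg].
    rewrite partialM//; apply: SumAdd.
      exact (SumOne (@smooth_partial _ i sf) sg).
    exact (SumOne sf (@smooth_partial _ i sg)).
  rewrite (_ : 'D_(e_ i) (f \+ g) = 'D_(e_ i) f \+ 'D_(e_ i) g); first exact: SumAdd.
  by apply/funext => x; exact: (deriveD ((reg _ hf).2 i x) ((reg _ hg).2 i x)).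
Qed.

Lemma smooth_prod (I : Type) (r : seq I) (F : I -> 'rV[R]_d -> R) :
  (forall j, smooth (F j)) -> smooth (fun x => \prod_(j <- r) F j x).
Proof.
move=> sF; elim: r => [|j r IHr].
  rewrite (_ : (fun _ => _) = cst 1); first exact: smooth_cst.
  by apply/funext => x; rewrite big_nil.
rewrite (_ : (fun _ => _) = F j \* (fun x => \prod_(j <- r) F j x)).
  exact (smoothM (sF j) IHr).
by apply/funext => x; rewrite big_cons.
Qed.

End smooth_functions.

(** * Box-shaped bump functions *)

Section flat_functions.
Context (R : realType).
Implicit Types (p : {poly R}) (t : R).

(** The class of the functions p(1/t) exp(-1/t), extended by 0 to t <= 0, is stable
under differentiation; p = 1 gives the classical flat function. *)
Definition flat p t : R := if 0 < t then p.[t^-1] * expR (- t^-1) else 0.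

Lemma flat_le0 p t : t <= 0 -> flat p t = 0.
Proof. by rewrite /flat leNgt; case: ifP. Qed.

(** With boundedness, this makes every flat function, and every difference quotient
of a flat function at 0, tend to 0. *)
Lemma flat_mulX p t : flat p t = t * flat (p * 'X) t.
Proof.
rewrite /flat; case: ifPn => [t0|_]; last by rewrite mulr0.
by rewrite hornerMX mulrA [t * _]mulrCA divff ?mulr1// gt_eqF.
Qed.

Lemma flat_bounded p : exists2 C : R, 0 <= C & forall t, `|flat p t| <= C.
Proof.
have mono n y : 0 <= y -> y ^+ n * expR (- y) <= n`!%:R :> R.
  move=> y0; rewrite expRN ler_pdivrMr ?expR_gt0//.
  case: n => [|n].
    by rewrite expr0 fact0 mul1r -expR0 ler_expR.
  rewrite mulrC -ler_pdivrMr ?ltr0n ?fact_gt0//.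
  by rewrite (le_trans _ (expR_ge1Dxn n y0))// lerDr.
exists (\sum_(i < size p) `|p`_i| * i`!%:R).
  by apply: sumr_ge0 => i _; rewrite mulr_ge0.
move=> t; rewrite /flat; case: ifPn => [t0|_]; last first.
  by rewrite normr0; apply: sumr_ge0 => i _; rewrite mulr_ge0.
rewrite horner_coef mulr_suml (le_trans (ler_norm_sum _ _ _))//.
apply: ler_sum => i _; rewrite -mulrA normrM ler_wpM2l//.
rewrite ger0_norm; first by rewrite mono// invr_ge0 ltW.
by rewrite mulr_ge0 ?expR_ge0// exprn_ge0// invr_ge0 ltW.
Qed.

Lemma flat_cvg0 p : flat p t @[t --> (0 : R)] --> (0 : R).
Proof.
have [C C0 pC] := flat_bounded (p * 'X).
have C1 : 0 < C + 1 by rewrite ltr_wpDl.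
apply/cvgr0Pnorm_le => e e0; near=> t.
rewrite flat_mulX normrM (@le_trans _ _ (`|t| * C)) ?ler_wpM2l//.
rewrite (@le_trans _ _ (`|t| * (C + 1))) ?ler_wpM2l ?lerDl//.
rewrite -ler_pdivlMr//; near: t.
have H : \forall s \near (0 : R), `|s| <= e / (C + 1).
  exact: (nbhs0_le (divr_gt0 e0 C1)).
exact: H.
Unshelve. all: by end_near. Qed.

(** With y = 1/t, the chain rule gives d/dt = - y^2 d/dy. *)
Lemma is_derive_flat p t :
  is_derive t 1 (flat p) (flat ((p - p^`()) * 'X ^+ 2) t).
Proof.
have [t0|t0|<-] := ltgtP 0 t.
- have E : {near t, (fun s => p.[s^-1] * expR (- s^-1)) =1 flat p}.
    near=> s; rewrite /flat ifT//; near: s; exact: (cvgr_gt _ cvg_id).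
  apply: (near_eq_is_derive E).
  have tn0 : t != 0 by rewrite gt_eqF.
  have dV : is_derive t 1 (fun s : R => s^-1) (- t ^- 2).
    by apply: is_derive_eq; [exact: is_deriveV|rewrite scaler1 /=].
  have dN : is_derive t 1 (fun s : R => - s^-1) (t ^- 2).
    by apply: is_derive_eq; rewrite opprK.
  have dp := @is_derive1_comp _ (horner p) _ _ _ _ (is_derive_poly p t^-1) dV.
  have de := @is_derive1_comp _ expR (fun s => - s^-1) t _ _ (is_derive_expR (- t^-1)) dN.
  apply: (is_derive_eq (is_deriveM dp de)).
  rewrite /flat t0 hornerM hornerXn hornerD hornerN /GRing.scale/= exprVn; ring.
- have E : {near t, cst 0 =1 flat p}.
    near=> s; rewrite flat_le0// ltW//; near: s; exact: lt_nbhsl.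
  apply: (near_eq_is_derive E).
  rewrite flat_le0 ?ltW//; exact: is_derive_cst.
- rewrite flat_le0//.
  have H : h^-1 *: ((flat p \o shift 0) (h *: (1:R)) - flat p 0) @[h --> (0:R)^'] --> (0:R).
    have H0 : (flat (p * 'X) h @[h --> (0:R)^'] --> (0:R)).
      by apply: cvg_trans (flat_cvg0 (p * 'X)); apply: cvg_app; exact: cvg_within.
    apply: cvg_trans H0; apply: near_eq_cvg; near=> h.
    have h0 : h != 0 by near: h; exact: nbhs_dnbhs_neq.
    rewrite /= addr0 [flat p 0]flat_le0// subr0 /GRing.scale/= mulr1 [flat p h]flat_mulX.
    by rewrite mulrA mulVf// mul1r.
  apply: DeriveDef; first by apply/cvg_ex; exists 0.
  exact: cvg_lim.
Unshelve. all: by end_near. Qed.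

End flat_functions.

Section coordinate_functions.
Context (R : realType) (d : nat).
Implicit Types (phi psi : R -> R) (i l : 'I_d) (x : 'rV[R]_d).

Local Notation e_ i := (delta_mx 0 i : 'rV[R]_d).

Lemma is_derive_coord phi (a : R) i l x : is_derive (x ord0 l) 1 phi a ->
  is_derive x (e_ i) (fun x => phi (x ord0 l)) ((i == l)%:R * a).
Proof.
move=> dphi.
have dl : is_derive (0 : R) 1 (fun h : R => h * (i == l)%:R + x ord0 l) (i == l)%:R.
  apply: is_derive_eq; rewrite addr0 /GRing.scale/= mulr0 add0r mulr1.
  done.
have E : is_derive (0 : R) 1 (fun h : R => phi ((h *: e_ i + x) ord0 l)) ((i == l)%:R * a).
  rewrite (_ : (fun h => _) = phi \o (fun h : R => h * (i == l)%:R + x ord0 l)); last first.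
    by apply/funext => h; rewrite /= !mxE eqxx/= eq_sym.
  by rewrite mulrC; apply: is_derive1_comp => //; rewrite mul0r add0r.
have [dE E0] := E.
split; first by apply/derivable1P; exact: dE.
rewrite -E0 /derive; set g1 := fun h => h^-1 *: _; set g2 := fun h => h^-1 *: _.
suff -> : g1 = g2 by []; rewrite funeqE /g1 /g2 => h /=.
by rewrite addr0 scale0r add0r [_%:A]mulr1.
Qed.

(** A function of one coordinate is smooth as soon as it lies in a class of
functions of one real variable that is stable under differentiation. *)
Lemma smooth_coord (S : set (R -> R)) l :
  (forall phi, S phi -> exists2 psi, S psi & forall t : R, is_derive t 1 phi (psi t)) ->
  forall phi, S phi -> smooth (fun x : 'rV[R]_d => phi (x ord0 l)).
Proof.
move=> SD phi Sphi.
apply: (@smooth_coinduction _ _ [set f | exists c phi, S phi /\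
  f = fun x : 'rV[R]_d => c * phi (x ord0 l)] _ _ (fun x => phi (x ord0 l))); last first.
  by exists 1, phi; split=> //; apply/funext => x; rewrite mul1r.
- move=> _ i [c [{Sphi}phi [Sphi ->]]].
  have [psi Spsi dphi] := SD _ Sphi; exists (c * (i == l)%:R), psi; split=> //.
  apply/funext => x; rewrite -mulrA.
  have [dP <-] := is_derive_coord i (dphi (x ord0 l)).
  exact: deriveZ.
- move=> _ [c [{Sphi}phi [Sphi ->]]].
  have [psi Spsi dphi] := SD _ Sphi; split=> [x|i x].
    apply: (@continuousM _ _ (cst c) (fun x : 'rV[R]_d => phi (x ord0 l))).
      exact: cst_continuous.
    apply: (@continuous_comp _ _ _ (fun x : 'rV[R]_d => x ord0 l) phi).
      exact: coord_continuous.
    have [dP _] := dphi (x ord0 l).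
    exact/differentiable_continuous/derivable1_diffP.
  have [dP _] := is_derive_coord i (dphi (x ord0 l)).
  exact: derivableZ.
Qed.

Lemma smooth_coordinate l : smooth (fun x : 'rV[R]_d => x ord0 l).
Proof.
apply: (@smooth_coord [set phi | exists a b : R, phi = fun t => a * t + b] _ _ id); last first.
  by exists 1, 0; apply/funext => t; rewrite mul1r addr0.
move=> _ [a [b ->]]; exists (fun=> a).
  by exists 0, a; apply/funext => t; rewrite mul0r add0r.
by move=> t; apply: is_derive_eq; rewrite addr0 /GRing.scale/= mulr1.
Qed.

Lemma smooth_flat p (c a : R) l : smooth (fun x : 'rV[R]_d => flat p (c * (x ord0 l - a))).
Proof.
apply: (@smooth_coord [set phi | exists p, phi = fun t => flat p (c * (t - a))] _ _
  (fun t => flat p (c * (t - a)))); last by exists p.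
move=> _ [{}p ->]; exists (fun t => flat (c *: ((p - p^`()) * 'X ^+ 2)) (c * (t - a))).
  by exists (c *: ((p - p^`()) * 'X ^+ 2)).
move=> t; have dl : is_derive t 1 (fun t : R => c * (t - a)) c.
  by apply: is_derive_eq; rewrite subr0 /GRing.scale/= mulr1.
have D := @is_derive1_comp _ (flat p) (fun t : R => c * (t - a)) t _ _
  (is_derive_flat p (c * (t - a))) dl.
apply: (is_derive_eq D).
by rewrite /flat; case: ifP => _; rewrite ?mul0r// hornerZ; ring.
Qed.

End coordinate_functions.

Section box_bumps.
Context (R : realType) (d : nat).
Implicit Types (a b : 'I_d -> R) (x : 'rV[R]_d) (n : nat).

Definition open_box a b : set 'rV[R]_d := [set x | forall i, a i < x ord0 i < b i].
Definition closed_box a b : set 'rV[R]_d := [set x | forall i, a i <= x ord0 i <= b i].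

(** The factor of index i vanishes unless a i < x_i < b i. As n grows, the steepness
n.+1 sends both flat functions to 1, because exp(-1/(n s)) tends to 1 for s > 0;
hence the bumps increase to the indicator of the open box. *)
Definition bump n a b x : R :=
  \prod_(i < d) (flat 1 (n.+1%:R * (x ord0 i - a i))
                 * flat 1 (- n.+1%:R * (x ord0 i - b i))).

Lemma smooth_bump n a b : smooth (bump n a b).
Proof.
apply: smooth_prod => i; apply: smoothM; exact: smooth_flat.
Qed.

Lemma flat1_itv (t : R) : 0 <= flat 1 t <= 1.
Proof.
rewrite /flat; case: ifPn => [t0|_]; last by rewrite lexx ler01.
by rewrite hornerE mul1r expR_ge0/= expR_le1 oppr_le0 invr_ge0 ltW.
Qed.

Lemma bump_itv n a b x : 0 <= bump n a b x <= 1.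
Proof.
apply/andP; split.
  apply: prodr_ge0 => i _.
  have /andP[? _] := flat1_itv (n.+1%:R * (x ord0 i - a i)).
  have /andP[? _] := flat1_itv (- n.+1%:R * (x ord0 i - b i)).
  exact: mulr_ge0.
apply: prodr_ile1 => i _.
have /andP[? ?] := flat1_itv (n.+1%:R * (x ord0 i - a i)).
have /andP[? ?] := flat1_itv (- n.+1%:R * (x ord0 i - b i)).
by rewrite mulr_ge0//= mulr_ile1.
Qed.

Lemma bump_out n a b x : ~ open_box a b x -> bump n a b x = 0.
Proof.
move=> /existsNP[i] /negP; rewrite negb_and -!leNgt => abi.
rewrite /bump (bigD1 i)//=; case/orP: abi => abi.
  by rewrite (@flat_le0 _ _ (_ * (_ - a i))) ?mul0r// mulr_ge0_le0// subr_le0.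
rewrite (@flat_le0 _ _ (_ * (_ - b i))) ?mulr0 ?mul0r//.
by rewrite mulr_le0_ge0 ?subr_ge0// oppr_le0.
Qed.

Lemma bump_cvg a b x : bump n a b x @[n --> \oo] --> ((x \in open_box a b)%:R : R).
Proof.
have [/set_mem xab|xab] := boolP (x \in _); last first.
  rewrite (_ : (fun n => bump n a b x) = cst 0); first exact: cvg_cst.
  by apply/funext => n /=; rewrite bump_out// => /mem_set; exact/negP.
have flat_cvg s : 0 < s -> flat 1 (n.+1%:R * s) @[n --> \oo] --> (1 : R).
  move=> s0.
  rewrite (_ : (fun n => _) = (fun n => expR (- (s^-1 * n.+1%:R^-1)))); last first.
    by apply/funext => n; rewrite /flat pmulr_rgt0// s0 hornerE mul1r invfM mulrC.
  rewrite -[X in _ --> X]expR0; apply: continuous_cvg; first exact: continuous_expR.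
  rewrite -[X in _ --> X]oppr0; apply: cvgN; rewrite -[X in _ --> X](mulr0 s^-1).
  by apply: cvgM; [exact: cvg_cst|exact: cvg_harmonic].
rewrite (_ : _%:R = \prod_(i < d) 1); last by rewrite big1_eq.
apply: cvg_big => [|i _]; first exact: mul_continuous.
rewrite -[X in _ --> X](mulr1 1); have /andP[ai bi] := xab i; apply: cvgM.
  by apply: flat_cvg; rewrite subr_gt0.
under eq_cvg do rewrite mulNr -mulrN.
by apply: flat_cvg; rewrite opprB subr_gt0.
Qed.

End box_bumps.

(** * Topology and measurability in R^d *)

Section euclidean_topology.
Context (R : realType) (d : nat).
Implicit Types (A D : set 'rV[R]_d).

Lemma measurable_coord_itv (J : 'I_d -> interval R) :
  measurable [set x : 'rV[R]_d | forall i, x ord0 i \in J i].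
Proof.
rewrite (_ : mkset _ = \bigcap_(i in [set: 'I_d]) (@rV_coord R d i @^-1` [set` J i])).
  apply: fin_bigcap_measurable => // i _; rewrite -[X in measurable X]setTI.
  exact: measurable_rV_coord.
by apply/seteqP; split=> x /= xJ i; [move=> _|have := xJ i I]; [exact: xJ|].
Qed.

Lemma measurable_open_box (a b : 'I_d -> R) : measurable (open_box a b).
Proof.
rewrite (_ : open_box a b = [set x | forall i, x ord0 i \in `]a i, b i[]).
  exact: measurable_coord_itv.
by apply/seteqP; split=> x xab i; have := xab i; rewrite in_itv.
Qed.

Lemma measurable_closed_box (a b : 'I_d -> R) : measurable (closed_box a b).
Proof.
rewrite (_ : closed_box a b = [set x | forall i, x ord0 i \in `[a i, b i]]).
  exact: measurable_coord_itv.
by apply/seteqP; split=> x xab i; have := xab i; rewrite in_itv.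
Qed.

(** The cubes with rational centre and edge 2 / (n+1) form a countable family, and
every point of an open set lies in one whose closure stays in the set. *)
Lemma open_bigcup_box A : open A ->
  exists (P : set nat) (a b : nat -> 'I_d -> R),
    (forall n, P n -> closed_box (a n) (b n) `<=` A) /\
    A = \bigcup_(n in P) open_box (a n) (b n).
Proof.
move=> oA.
pose q (n : nat) : 'rV[rat]_d * nat := odflt (0, 0%N) (unpickle n).
pose a n i : R := ratr ((q n).1 ord0 i) - (q n).2.+1%:R^-1.
pose b n i : R := ratr ((q n).1 ord0 i) + (q n).2.+1%:R^-1.
exists [set n | closed_box (a n) (b n) `<=` A], a, b; split=> //.
apply/seteqP; split=> [x Ax|x [n + xab]]; last first.
  by apply => i; have /andP[? ?] := xab i; rewrite !ltW.
have /nbhs_ballP[/= e e0 eA] : nbhs x A by exact: open_nbhs_nbhs.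
have [k ke] : exists k : nat, k.+1%:R^-1 < e / 2.
  have e20 : 0 < e / 2 by rewrite divr_gt0.
  have [k _ /(_ k (leqnn _))] := @near_infty_natSinv_lt R (PosNum e20).
  by exists k.
have /choice[r rx] : forall i : 'I_d, exists r : rat,
    ratr r \in `]x ord0 i - k.+1%:R^-1, x ord0 i + k.+1%:R^-1[.
  by move=> i; apply: rat_in_itvoo; rewrite ltrD2l gtrN ?invr_gt0.
exists (pickle (\row_i r i, k)).
  move=> y yab; apply: eA; split=> // i j; rewrite ord1; have := yab j; have := rx j.
  rewrite /a /b /q pickleK/= mxE in_itv/= /ball/= => /andP[r1 r2] /andP[y1 y2].
  rewrite ltr_norml -[x 0 j]/(x ord0 j) -[y 0 j]/(y ord0 j).
  move: ke r1 r2 y1 y2; move: (x ord0 j) (y ord0 j) (ratr (r j)) (k.+1%:R^-1) => X Y Z c.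
  by move=> *; apply/andP; split; lra.
move=> j; have := rx j.
rewrite /a /b /q pickleK/= mxE in_itv/= => /andP[].
move: (x ord0 j) (ratr (r j)) (k.+1%:R^-1) => X Z c.
by move=> *; apply/andP; split; lra.
Qed.

Lemma open_measurable_rV A : open A -> measurable A.
Proof.
move=> /open_bigcup_box[P [a [b [_ ->]]]].
by apply: bigcup_measurable => n _; exact: measurable_open_box.
Qed.

Lemma continuous_measurable_rV D (f : 'rV[R]_d -> R) :
  measurable D -> continuous f -> measurable_fun D f.
Proof.
move=> mD /continuousP cf _;
apply: (measurability _ (measurable_realfun.RGenOpens.measurableE R)) => //.
move=> _ [_ [a [b ->] <-]]; apply: measurableI => //.
by apply: open_measurable_rV; apply: cf; exact: interval_open.
Qed.

Lemma closed_box_compact (a b : 'I_d -> R) : compact (closed_box a b).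
Proof.
rewrite (_ : closed_box a b = [set v : 'rV[R]_d | forall i, `[a i, b i]%classic (v ord0 i)]).
  by apply: (@rV_compact _ _ (fun i => `[a i, b i]%classic)) => i; exact: segment_compact.
by apply/seteqP; split=> x xab i; have := xab i; rewrite /= in_itv.
Qed.

Lemma bounded_sub_box A : bounded_set A ->
  exists2 M : R, 0 < M & A `<=` closed_box (fun=> - M) (fun=> M).
Proof.
move=> /pinfty_ex_gt0[M M0 AM]; exists M => // x /AM xM i.
rewrite -ler_norml (le_trans _ xM)// [leRHS]/Num.norm/= mx_normrE.
by apply: (le_trans _ (le_bigmax _ _ (ord0, i))).
Qed.

End euclidean_topology.

(** * Lebesgue measure under translations and reflections *)

Section measure_preserving.
Context (R : realType).
Local Open Scope ereal_scope.

Definition measure_preserving (d : measure_display) (T : measurableType d)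
    (mu : set T -> \bar R) (g : T -> T) : Prop :=
  measurable_fun [set: T] g /\ forall A, measurable A -> mu (g @^-1` A) = mu A.

Lemma measure_preservingN :
  measure_preserving (@lebesgue_measure R) (-%R : measurableTypeR R -> measurableTypeR R).
Proof.
split; last exact: lebesgue_measureN.
apply: continuous_measurable_fun; exact: oppr_continuous.
Qed.

Lemma measure_preserving_translation (c : R) :
  measure_preserving (@lebesgue_measure R) (+%R c : measurableTypeR R -> measurableTypeR R).
Proof.
have mc : measurable_fun [set: measurableTypeR R]
    (+%R c : measurableTypeR R -> measurableTypeR R).
  by apply: measurable_funD.
split=> // A mA.
pose g := MeasurableFun.Pack (MeasurableFun.Class (isMeasurableFun.Build _ _ _ _ _ mc)).
apply/esym/(@lebesgue_measure_unique _ (pushforward (@lebesgue_measure R) g)) => //.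
move=> _ [[a b]] _ <-.
transitivity (lebesgue_measure `](a - c)%R, (b - c)%R]%classic); last first.
  rewrite /pushforward; congr (lebesgue_measure _).
  by apply/seteqP; split=> x /=; rewrite !in_itv/= ltrBlDl lerBrDl.
rewrite !lebesgue_measure_itv/= !lte_fin ltrD2r; case: ifP => // _.
by rewrite -!EFinD; congr (_%:E); ring.
Qed.

Lemma measure_preserving_id (d : measure_display) (T : measurableType d)
    (mu : set T -> \bar R) : measure_preserving mu id.
Proof. by split. Qed.

(** It suffices that the product map preserve the measure of rectangles, by
uniqueness of the product measure. Translations and coordinate reflections are the
two cases of interest. *)
Lemma measure_preserving_rV n (g : 'I_n -> R -> R) :
  (forall i, measure_preserving (@lebesgue_measure R)
     (g i : measurableTypeR R -> measurableTypeR R)) ->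
  measure_preserving (lebesgue_rV R n) (fun x => \row_i g i (x ord0 i))%R.
Proof.
elim: n g => [|n IHn] g pg.
  rewrite (_ : (fun x => _) = id); first exact: measure_preserving_id.
  by apply/funext => x; apply/rowP => -[].
set G := (fun x : 'rV[R]_n.+1 => _).
pose g0 := g ord0 : measurableTypeR R -> measurableTypeR R.
pose G' (x : 'rV[R]_n) : 'rV[R]_n := (\row_i g (lift ord0 i) (x ord0 i))%R.
have [mG' pG'] : measure_preserving (lebesgue_rV R n) G'.
  exact: (IHn (fun i => g (lift ord0 i)) (fun i => pg (lift ord0 i))).
have [mg0 pg0] := pg ord0.
have mG : measurable_fun [set: 'rV[R]_n.+1] G.
  apply: measurable_rVP => i.
  rewrite (_ : _ \o _ =
    (g i : measurableTypeR R -> measurableTypeR R) \o @rV_coord R n.+1 i); last first.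
    by apply/funext => x; rewrite /rV_coord /= mxE.
  by apply: measurableT_comp (measurable_rV_coord _); exact: (pg i).1.
split=> // A mA.
have mcons B : measurable B -> measurable (@rV_cons R n @^-1` B).
  by move=> mB; rewrite -[X in measurable X]setTI; exact: measurable_rV_cons.
pose h (p : measurableTypeR R * 'rV[R]_n) := (g0 p.1, G' p.2).
have mh : measurable_fun [set: measurableTypeR R * 'rV[R]_n] h.
  by apply: measurable_fun_pair; apply: measurableT_comp.
pose hm := MeasurableFun.Pack (MeasurableFun.Class (isMeasurableFun.Build _ _ _ _ _ mh)).
have Ep p : G (rV_cons p) = rV_cons (h p).
  apply/rowP => i; rewrite !mxE; case: (unliftP ord0 i) => [j ->|->].
    by rewrite mxE.
  by [].
have E : @rV_cons R n @^-1` (G @^-1` A) = h @^-1` (@rV_cons R n @^-1` A).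
  by apply/funext => p; rewrite /preimage/= Ep.
rewrite /= /lebesgue_rV_step /pushforward E.
apply/esym.
apply: (@product_measure_unique _ _ _ _ _ (@lebesgue_measure R) (lebesgue_rV R n)
  (pushforward (@lebesgue_measure R \x lebesgue_rV R n) hm)).
  move=> B C mB mC.
  transitivity ((@lebesgue_measure R \x lebesgue_rV R n) ((g0 @^-1` B) `*` (G' @^-1` C))).
    by [].
  have mB' : measurable (g0 @^-1` B) by rewrite -[X in measurable X]setTI; exact: mg0.
  have mC' : measurable (G' @^-1` C) by rewrite -[X in measurable X]setTI; exact: mG'.
  by rewrite (product_measure1E _ _ mB' mC') pG'//; congr (_ * _); exact: pg0.
exact: mcons.
Qed.

Lemma lebesgue_rV_closed_box n (a b : 'I_n -> R) : lebesgue_rV R n (closed_box a b) < +oo.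
Proof.
elim: n a b => [|n IHn] a b /=.
  by rewrite diracE; case: (_ \in _); rewrite ltry.
rewrite /lebesgue_rV_step /pushforward.
rewrite (_ : _ @^-1` _ = `[a ord0, b ord0]%classic `*`
    closed_box (fun i : 'I_n => a (lift ord0 i)) (fun i => b (lift ord0 i))); last first.
  apply/seteqP; split=> [[t v]|[t v] []] /=; rewrite in_itv/=.
    move=> tv; split; first by have := tv ord0; rewrite mxE unlift_none.
    by move=> i; have := tv (lift ord0 i); rewrite mxE liftK.
  move=> tab vab i; rewrite mxE; case: (unliftP ord0 i) => [j ->|->] //=.
rewrite product_measure1E//; last exact: measurable_closed_box.
have ab_fin : lebesgue_measure `[a ord0, b ord0] < +oo.
  by rewrite lebesgue_measure_itv/=; case: ifP => // _; exact: ltry.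
by rewrite lte_mul_pinfty// ?ge0_fin_numE.
Qed.

End measure_preserving.

(** * Integration by parts *)

Section dominated.
Context (d : measure_display) (T : measurableType d) (R : realType).
Variable mu : {measure set T -> \bar R}.

Lemma Rintegral_dominated_cvg (D : set T) (f_ : nat -> T -> R) (f g : T -> R) :
  measurable D -> (forall n, measurable_fun D (f_ n)) -> measurable_fun D f ->
  mu.-integrable D (EFin \o g) ->
  (forall x, D x -> f_ n x @[n --> \oo] --> f x) ->
  (forall n x, D x -> `|f_ n x| <= g x) ->
  (\int[mu]_(x in D) f_ n x)%R @[n --> \oo] --> (\int[mu]_(x in D) f x)%R.
Proof.
move=> mD mf_ mf ig f_cvg f_le.
have mE n : measurable_fun D (EFin \o f_ n) by exact/measurable_EFinP.
have mfE : measurable_fun D (EFin \o f) by exact/measurable_EFinP.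
have f_cvgE : \forall x \ae mu, D x -> (EFin \o f_ n) x @[n --> \oo] --> (EFin \o f) x.
  by apply: aeW => x Dx; apply: cvg_EFin; [exact: nearW|exact: f_cvg].
have f_leE : \forall x \ae mu, forall n, D x -> (`|(EFin \o f_ n) x| <= (EFin \o g) x)%E.
  by apply: aeW => x n Dx; rewrite /= lee_fin; exact: f_le.
have [i_f _ I_cvg] := dominated_convergence mD mE mfE f_cvgE ig f_leE.
apply: fine_cvg; rewrite fineK//; exact: integrable_fin_num.
Qed.

End dominated.

Section integration_by_parts.
Context (R : realType) (d : nat).
Implicit Types (f F phi : 'rV[R]_d -> R) (i : 'I_d) (x : 'rV[R]_d).

Local Notation e_ i := (delta_mx 0 i : 'rV[R]_d).
Local Notation mu := (lebesgue_rV R d).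

Lemma Rintegral_measure_preserving (g : 'rV[R]_d -> 'rV[R]_d) D f :
  measure_preserving mu g -> measurable D -> measurable_fun [set: 'rV[R]_d] f ->
  mu.-integrable (g @^-1` D) (EFin \o (f \o g)) ->
  (\int[mu]_(x in g @^-1` D) f (g x) = \int[mu]_(x in D) f x)%R.
Proof.
move=> [mg pg] mD mf fg; rewrite /Rintegral; congr fine.
have mf' : measurable_fun [set: 'rV[R]_d] (EFin \o f) by exact/measurable_EFinP.
have := @integral_pushforward _ _ _ _ R g mg mu D (EFin \o f) mf' fg mD.
move=> <-; apply: eq_measure_integral => A mA _.
exact: (pg A mA).
Qed.

Lemma integrable_indic_box (a b : 'I_d -> R) :
  mu.-integrable [set: 'rV[R]_d] (fun x => (\1_(closed_box a b) x)%:E).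
Proof.
have mB := measurable_closed_box a b.
apply/integrableP; split; first exact/measurable_EFinP.
rewrite (eq_integral (fun x => (\1_(closed_box a b) x)%:E)); last first.
  by move=> t _; rewrite gee0_abs// lee_fin.
by rewrite integral_indic// setIT; exact: lebesgue_rV_closed_box.
Qed.

Lemma integrable_cst_box C (a b : 'I_d -> R) :
  mu.-integrable [set: 'rV[R]_d] (EFin \o (fun x => C * \1_(closed_box a b) x)).
Proof.
rewrite (_ : _ \o _ = (fun x => C%:E * (\1_(closed_box a b) x)%:E)%E).
  by apply: integrableZl => //; exact: integrable_indic_box.
by apply/funext => x /=; rewrite EFinM.
Qed.

Lemma le_cst_box f (a b : 'I_d -> R) C : (forall x, `|f x| <= C) ->
  (forall x, ~ closed_box a b x -> f x = 0) ->
  forall x, `|f x| <= C * \1_(closed_box a b) x.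
Proof.
move=> fC f0 x; rewrite indicE.
have [/set_mem xab|xab] := boolP (x \in _); first by rewrite mulr1.
by rewrite mulr0 normr_le0 f0// => /mem_set; exact/negP.
Qed.

Lemma bounded_support_integrable f (a b : 'I_d -> R) (C : R) :
  measurable_fun [set: 'rV[R]_d] f -> (forall x, `|f x| <= C) ->
  (forall x, ~ closed_box a b x -> f x = 0) ->
  mu.-integrable [set: 'rV[R]_d] (EFin \o f).
Proof.
move=> mf fC f0.
apply: (@le_integrable _ _ _ _ _ _ _ (EFin \o (fun x => C * \1_(closed_box a b) x))) => //.
- exact/measurable_EFinP.
- move=> x _; rewrite /= lee_fin; apply: (le_trans (le_cst_box fC f0 x)).
  exact: ler_norm.
- exact: integrable_cst_box.
Qed.

Lemma continuous_bounded_support f (a b : 'I_d -> R) : continuous f ->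
  (forall x, ~ closed_box a b x -> f x = 0) -> exists C : R, forall x, `|f x| <= C.
Proof.
move=> cf f0.
have /compact_bounded/pinfty_ex_gt0[C C0 fC] : compact (f @` closed_box a b).
  apply: continuous_compact; last exact: closed_box_compact.
  exact: continuous_subspaceT.
exists C => x; have [xab|xab] := pselect (closed_box a b x); last by rewrite f0// normr0 ltW.
by apply: fC; exists x.
Qed.

Lemma is_derive_line F i x (t : R) : smooth F ->
  is_derive t 1 (fun s : R => F (s *: e_ i + x)) ('D_(e_ i) F (t *: e_ i + x)).
Proof.
move=> sF; have dF := @smooth_derivable _ _ _ i (t *: e_ i + x) sF.
have E : (fun h : R => h^-1 *: (((fun s : R => F (s *: e_ i + x)) \o shift t) (h *: 1)
      - F (t *: e_ i + x)))
  = (fun h : R => h^-1 *: ((F \o shift (t *: e_ i + x)) (h *: e_ i) - F (t *: e_ i + x))).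
  by apply/funext => h /=; rewrite [h%:A]mulr1 scalerDl addrA.
by split; [rewrite /derivable E|rewrite /derive E].
Qed.

(** By translation invariance the difference quotients of F in the direction i have
integral 0. They converge to the derivative and, by the mean value theorem, are
dominated by its supremum on a box, so that the derivative has integral 0 too. *)
Lemma Rintegral_partial_eq0 F i (a b : 'I_d -> R) : smooth F ->
  (forall x, ~ closed_box a b x -> F x = 0) ->
  (\int[mu]_(x in [set: 'rV[R]_d]) 'D_(e_ i) F x = 0)%R.
Proof.
move=> sF F0.
(* The box enlarged by 1 contains the supports of all translates by h <= 1. *)
pose a' j := a j - 1; pose b' j := b j + 1.
have F0' x t : `|t| <= 1 -> ~ closed_box a' b' x -> F (t *: e_ i + x) = 0.
  move=> t1 xab; apply: F0 => txab; apply: xab => j.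
  have := txab j; rewrite !mxE eqxx/= /a' /b'.
  move: t1; rewrite ler_norml; case: (j == i) => /=; rewrite ?mulr1 ?mulr0.
    by move=> /andP[? ?] /andP[? ?]; apply/andP; split; lra.
  by move=> /andP[? ?] /andP[? ?]; apply/andP; split; lra.
have F0'' x : ~ closed_box a' b' x -> F x = 0.
  by move=> xab; rewrite -(F0' _ 0 _ xab) ?scale0r ?add0r// normr0.
have DF0 x : ~ closed_box a' b' x -> 'D_(e_ i) F x = 0.
  move=> xab; have := @derive_val _ _ _ _ _ _ _ (is_derive_line i x 0 sF).
  rewrite scale0r add0r => <-.
  have E : {near (0 : R), cst 0 =1 (fun s : R => F (s *: e_ i + x))}.
    near=> s; rewrite /= (F0' _ s) //; near: s; exact: (nbhs0_le ltr01).
  exact: (@derive_val _ _ _ _ _ _ _ (near_eq_is_derive E (is_derive_cst 0 _ _))).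
have cDF : continuous ('D_(e_ i) F).
  by move=> x; exact: (smooth_continuous (smooth_partial i sF)).
have cF : continuous F by move=> x; exact: (smooth_continuous sF).
have mF : measurable_fun [set: 'rV[R]_d] F by exact: continuous_measurable_rV.
have mDF : measurable_fun [set: 'rV[R]_d] ('D_(e_ i) F) by exact: continuous_measurable_rV.
have [C DFC] := continuous_bounded_support cDF DF0.
have [C' FC'] := continuous_bounded_support cF F0''.
pose h n : R := n.+1%:R^-1.
have h0 n : 0 < h n by rewrite invr_gt0.
have h1 n : h n <= 1 by rewrite invf_le1 ?ler1n.
pose q n x := (h n)^-1 * (F (h n *: e_ i + x) - F x).
have pT n : measure_preserving mu (fun x => h n *: e_ i + x).
  have := @measure_preserving_rV R d (fun j => +%R ((h n *: e_ i) ord0 j)).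
  rewrite (_ : (fun x => \row_j _) = (fun x => h n *: e_ i + x)).
    by apply => j; exact: measure_preserving_translation.
  by apply/funext => x; apply/rowP => j; rewrite !mxE.
have mT n : measurable_fun [set: 'rV[R]_d] (fun x => F (h n *: e_ i + x)).
  by apply: (measurableT_comp mF); exact: (pT n).1.
have iF : mu.-integrable [set: 'rV[R]_d] (EFin \o F).
  exact: bounded_support_integrable mF FC' F0''.
have iT n : mu.-integrable [set: 'rV[R]_d] (EFin \o (fun x => F (h n *: e_ i + x))).
  apply: (bounded_support_integrable (mT n) (fun x => FC' _)) => x.
  by apply: F0'; rewrite ger0_norm ?h1// ltW.
have mq n : measurable_fun [set: 'rV[R]_d] (q n).
  by apply: measurable_funM => //; apply: measurable_funB.
have qC n x : `|q n x| <= C.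
  have [c _] := @MVT _ (fun s : R => F (s *: e_ i + x))
    (fun s : R => 'D_(e_ i) F (s *: e_ i + x)) 0 (h n) (h0 n)
    (fun s _ => is_derive_line i x s sF)
    (derivable_within_continuous (fun s _ => ex_derive (is_derive := is_derive_line i x s sF))).
  by rewrite scale0r add0r subr0 /q => ->; rewrite mulrCA mulVf ?mulr1 ?gt_eqF.
have q0 n x : ~ closed_box a' b' x -> q n x = 0.
  by move=> xab; rewrite /q (F0'' x)// F0' ?subr0 ?mulr0// ger0_norm ?h1// ltW.
have Iq n : (\int[mu]_(x in [set: 'rV[R]_d]) q n x = 0)%R.
  rewrite RintegralZl//; last first.
    have := @integrableB _ _ _ mu _ measurableT _ _ (iT n) iF.
    by apply: eq_integrable => // x _; rewrite /= EFinB.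
  rewrite RintegralB//.
  rewrite (Rintegral_measure_preserving (pT n) measurableT mF (iT n)).
  by rewrite subrr mulr0.
have q_cvg x : q n x @[n --> \oo] --> 'D_(e_ i) F x.
  have dF := @smooth_derivable _ _ _ i x sF.
  have /cvgr_dnbhsP/(_ h) := dF; apply; split=> [m|]; first by rewrite gt_eqF.
  exact: cvg_harmonic.
have := @Rintegral_dominated_cvg _ _ _ mu setT q ('D_(e_ i) F)
  (fun x => C * \1_(closed_box a' b') x) measurableT mq mDF (integrable_cst_box C a' b')
  (fun x _ => q_cvg x) (fun n x _ => le_cst_box (qC n) (q0 n) x).
rewrite (_ : (fun n => _) = cst 0); last by apply/funext => n /=; rewrite Iq.
by move=> /cvg_lim <-//; rewrite lim_cst.
Unshelve. all: by end_near. Qed.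

End integration_by_parts.

Section test_functions.
Context (R : realType) (d : nat) (Omega : set 'rV[R]_d).
Implicit Types (f phi : 'rV[R]_d -> R) (i : 'I_d) (x : 'rV[R]_d).

Local Notation e_ i := (delta_mx 0 i : 'rV[R]_d).
Local Notation mu := (lebesgue_rV R d).
Local Notation test := (test_function Omega).

Lemma test_bump n a b : closed_box a b `<=` Omega -> test (bump n a b).
Proof.
move=> abO; split; first exact: smooth_bump.
exists (closed_box a b); first by split=> //; exact: closed_box_compact.
move=> x xab; apply: bump_out => abx; apply: xab => i.
by have /andP[? ?] := abx i; rewrite !ltW.
Qed.

Lemma test_smooth phi : test phi -> smooth phi. Proof. by case. Qed.

Lemma test_support phi : test phi ->
  exists a b, (forall x, ~ (closed_box a b `&` Omega) x -> phi x = 0).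
Proof.
move=> [_ [K [cK KO] phiK]].
have [M _ KM] := bounded_sub_box (compact_bounded cK).
exists (fun=> - M), (fun=> M) => x xM; apply: phiK => Kx.
by apply: xM; split; [exact: KM|exact: KO].
Qed.

Lemma test_partial phi i : test phi -> test ('D_(e_ i) phi).
Proof.
move=> [sphi [K [cK KO] phiK]]; split; first exact: smooth_partial.
exists K => // x Kx.
have cl : closed K by apply: compact_closed => //; exact: norm_hausdorff.
have E : {near x, cst 0 =1 phi}.
  have : nbhs x (~` K) by apply: open_nbhs_nbhs; split => //; exact: closed_openC.
  by apply: filterS => y Ky; rewrite phiK.
have [_ <-] := near_eq_is_derive E (is_derive_cst 0 x (e_ i)).
by [].
Qed.

Lemma test_iter_partial s phi : test phi -> test (iter_partial s phi).
Proof. by move=> tphi; elim: s => [|i s IHs] //; exact: test_partial. Qed.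

Lemma smooth_mul_test f phi : smooth f -> test phi -> test (f \* phi).
Proof.
move=> sf [sphi [K ? phiK]]; split; first exact: smoothM.
by exists K => // x /phiK /= ->; rewrite mulr0.
Qed.

Lemma test_integrable phi : test phi -> mu.-integrable setT (EFin \o phi).
Proof.
move=> tphi; have [a [b phi0]] := test_support tphi.
have cphi : continuous phi by move=> x; apply: smooth_continuous; exact: test_smooth.
have phi0' x : ~ closed_box a b x -> phi x = 0 by move=> xab; apply: phi0 => -[].
have [C phiC] := continuous_bounded_support cphi phi0'.
apply: (bounded_support_integrable _ phiC phi0').
exact: continuous_measurable_rV.
Qed.

Lemma Rintegral_test phi : test phi ->
  (\int[mu]_(x in Omega) phi x = \int[mu]_(x in setT) phi x)%R.
Proof.
move=> tphi; have [a [b phi0]] := test_support tphi.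
rewrite Rintegral_mkcond; apply: eq_Rintegral => x _; rewrite patchE.
by case: ifPn => // /negP xO; rewrite phi0// => -[_ /mem_set].
Qed.

Lemma Rintegral_test_partial phi i : test phi ->
  (\int[mu]_(x in Omega) 'D_(e_ i) phi x = 0)%R.
Proof.
move=> tphi; rewrite Rintegral_test; last exact: test_partial.
have [a [b phi0]] := test_support tphi.
apply: (@Rintegral_partial_eq0 _ _ _ _ a b); first exact: test_smooth.
by move=> x xab; apply: phi0 => -[].
Qed.

Lemma smooth_dot_partial f phi i : open Omega -> smooth f -> test phi ->
  L2_dot Omega f ('D_(e_ i) phi) = - L2_dot Omega ('D_(e_ i) f) phi.
Proof.
move=> oO sf tphi; apply/eqP; rewrite -addr_eq0 addrC; apply/eqP.
have mO := open_measurable_rV oO.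
have t1 := smooth_mul_test (smooth_partial i sf) tphi.
have t2 := smooth_mul_test sf (test_partial i tphi).
rewrite /L2_dot -RintegralD//.
- rewrite -[RHS](Rintegral_test_partial i (smooth_mul_test sf tphi)).
  by rewrite (partialM i sf (test_smooth tphi)).
- by apply: integrableS (test_integrable t1).
- by apply: integrableS (test_integrable t2).
Qed.

(** Moving the derivatives one by one to the other factor reverses their order, so
that the weak partial derivative of index s of a smooth f is the classical one of
index rev s. *)
Lemma smooth_dot_iter_partial f phi s : open Omega -> smooth f -> test phi ->
  L2_dot Omega f (iter_partial s phi) =
  (-1) ^+ size s * L2_dot Omega (iter_partial (rev s) f) phi.
Proof.
move=> oO sf tphi; elim: s f sf => [|i s IHs] f sf; first by rewrite expr0 mul1r.
rewrite /= (smooth_dot_partial i oO sf (test_iter_partial s tphi)).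
rewrite IHs; last exact: smooth_partial.
by rewrite rev_cons iter_partial_rcons exprS -mulrA mulN1r.
Qed.

(** Poincare's inequality. The integral of d_i (x_i phi^2) = phi^2 + 2 x_i phi d_i phi
vanishes, and -2 x_i phi d_i phi <= phi^2 / 2 + 2 M^2 (d_i phi)^2 on Omega. *)
Lemma test_poincare phi i (M : R) : open Omega ->
  Omega `<=` closed_box (fun=> - M) (fun=> M) -> test phi ->
  L2_sqnorm Omega phi <= 4 * M ^+ 2 * L2_sqnorm Omega ('D_(e_ i) phi).
Proof.
move=> oO OM tphi; have mO := open_measurable_rV oO.
pose X (x : 'rV[R]_d) : R := x ord0 i; pose D : 'rV[R]_d -> R := 'D_(e_ i) phi.
have sX : smooth X by exact: smooth_coordinate.
have DX : 'D_(e_ i) X = cst 1.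
  apply/funext => x; have [_ ->] := @is_derive_coord _ _ id 1 i i x (is_derive_id _ _).
  by rewrite eqxx mulr1.
have sphi := test_smooth tphi; have tD : test D by exact: test_partial.
have tXp : test (X \* phi) by exact: smooth_mul_test.
have := Rintegral_test_partial i (smooth_mul_test (test_smooth tXp) tphi).
have DE : 'D_(e_ i) (X \* phi \* phi) =
    fun x => (phi x + X x * D x) * phi x + X x * phi x * D x.
  rewrite (partialM i (smoothM sX sphi) sphi) (partialM i sX sphi) DX.
  by apply/funext => x /=; rewrite mul1r.
rewrite DE => I0.
have iS psi c : test psi -> mu.-integrable Omega (EFin \o (fun x => c * (psi x * psi x))).
  move=> tpsi.
  have ti := integrableS measurableT mO (@subsetT _ _)
    (test_integrable (smooth_mul_test (test_smooth tpsi) tpsi)).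
  by have := integrableZl mO c ti; apply: eq_integrable.
have H : 2^-1 * L2_sqnorm Omega phi - 2 * M ^+ 2 * L2_sqnorm Omega D <= 0.
  rewrite /L2_sqnorm /L2_dot -I0.
  rewrite -!RintegralZl//; last 2 first.
  - have := iS phi 1 tphi; rewrite (_ : (fun x => _) = (fun x => phi x * phi x))//.
    by apply/funext => x; rewrite mul1r.
  - have := iS D 1 tD; rewrite (_ : (fun x => _) = (fun x => D x * D x))//.
    by apply/funext => x; rewrite mul1r.
  rewrite -RintegralB//; [|exact: iS|exact: iS].
  apply: le_Rintegral => //.
  - have := integrableB mO (iS phi 2^-1 tphi) (iS D (2 * M ^+ 2) tD).
    by apply: eq_integrable => // x _; rewrite /= EFinB.
  - have := integrableS measurableT mO (@subsetT _ _)
      (test_integrable (test_partial i (smooth_mul_test (test_smooth tXp) tphi))).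
    by rewrite DE.
  - move=> x Ox; have /andP[x1 x2] := OM _ Ox i.
    have M2 : 0 <= (M - X x) * (M + X x)
      by rewrite mulr_ge0 ?subr_ge0// -lerBlDl sub0r.
    rewrite -subr_ge0; move: (phi x) (X x) (D x) M2 => p t q M2.
    have -> : (p + t * q) * p + t * p * q - (2^-1 * (p * p) - 2 * M ^+ 2 * (q * q)) =
      2^-1 * (p + 2 * t * q) ^+ 2 + 2 * ((M - t) * (M + t)) * q ^+ 2 by field.
    by rewrite addr_ge0// mulr_ge0 ?sqr_ge0// mulr_ge0.
rewrite -/D; move: H; move: (L2_sqnorm _ phi) (L2_sqnorm _ D) => u v H; lra.
Qed.

End test_functions.

(** * The scalar product of L^2 *)

Section L2_space.
Context (R : realType) (d : nat) (Omega : set 'rV[R]_d).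
Hypothesis mO : measurable Omega.
Implicit Types (u v w : 'rV[R]_d -> R).

Local Notation mu := (lebesgue_rV R d).
Local Notation dot := (L2_dot Omega).
Local Notation sqnorm := (L2_sqnorm Omega).
Local Notation L2 := (L2 Omega).

Lemma L2_mul_integrable u v : L2 u -> L2 v ->
  mu.-integrable Omega (EFin \o (fun x => u x * v x)).
Proof.
move=> [mu_ iu] [mv iv].
apply: (@le_integrable _ _ _ _ _ _ _ (fun x => (u x ^+ 2)%:E + (v x ^+ 2)%:E)%E) => //.
- by apply/measurable_EFinP; exact: measurable_funM.
- move=> x _; rewrite /= lee_fin [leRHS]ger0_norm ?addr_ge0 ?sqr_ge0// ler_norml.
  move: (u x) (v x) => a b; apply/andP.
  have p := sqr_ge0 (a + b); have m := sqr_ge0 (a - b).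
  have pa := sqr_ge0 a; have pb := sqr_ge0 b.
  by split; rewrite ?expr2 in p m pa pb *; nra.
- exact: integrableD.
Qed.

Lemma L2D u v : L2 u -> L2 v -> L2 (u + v).
Proof.
move=> Lu Lv; split; first by apply: measurable_funD; [exact: Lu.1|exact: Lv.1].
have := integrableD mO (integrableD mO Lu.2 Lv.2) (integrableZl mO 2 (L2_mul_integrable Lu Lv)).
apply: eq_integrable => // x _ /=.
have -> : (u + v) x = u x + v x by [].
by rewrite -EFinM -!EFinD; congr (_%:E); ring.
Qed.

Lemma L2Z a u : L2 u -> L2 (a *: u).
Proof.
move=> Lu; split; first by apply: measurable_funM => //; exact: Lu.1.
have := integrableZl mO (a ^+ 2) Lu.2.
apply: eq_integrable => // x _ /=.
have -> : (a *: u) x = a * u x by [].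
by rewrite -EFinM; congr (_%:E); ring.
Qed.

Lemma L2_0 : L2 0.
Proof.
split; first exact: measurable_cst.
apply: (eq_integrable _ (cst 0%E)) => //; last exact: integrable0.
by move=> x _; rewrite /= expr0n.
Qed.

Lemma L2B u v : L2 u -> L2 v -> L2 (u - v).
Proof. by move=> Lu Lv; rewrite -scaleN1r; apply: L2D => //; exact: L2Z. Qed.

Lemma L2_sum (I : Type) (r : seq I) (F : I -> 'rV[R]_d -> R) :
  (forall i, L2 (F i)) -> L2 (\sum_(i <- r) F i).
Proof.
move=> LF; elim: r => [|i r IHr]; first by rewrite big_nil; exact: L2_0.
by rewrite big_cons; exact: L2D.
Qed.

Lemma dotC u v : dot u v = dot v u.
Proof. by rewrite /L2_dot; apply: eq_Rintegral => x _; rewrite mulrC. Qed.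

Lemma dotDl u v w : L2 u -> L2 v -> L2 w -> dot (u + v) w = dot u w + dot v w.
Proof.
move=> Lu Lv Lw; rewrite /L2_dot -RintegralD//; try exact: L2_mul_integrable.
by apply: eq_Rintegral => x _; rewrite -mulrDl.
Qed.

Lemma dotZl a u v : L2 u -> L2 v -> dot (a *: u) v = a * dot u v.
Proof.
move=> Lu Lv; rewrite /L2_dot -RintegralZl//; try exact: L2_mul_integrable.
by apply: eq_Rintegral => x _; rewrite mulrA.
Qed.

Lemma dot0l v : dot 0 v = 0.
Proof.
rewrite /L2_dot (_ : (fun _ => _) = cst 0); last by apply/funext => x; rewrite mul0r.
by rewrite Rintegral_cst// mul0r.
Qed.

Lemma dot0r v : dot v 0 = 0.
Proof. by rewrite dotC dot0l. Qed.

Lemma dotBl u v w : L2 u -> L2 v -> L2 w -> dot (u - v) w = dot u w - dot v w.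
Proof.
move=> Lu Lv Lw; rewrite -scaleN1r dotDl ?dotZl ?mulN1r//; exact: L2Z.
Qed.

Lemma dotDr u v w : L2 u -> L2 v -> L2 w -> dot w (u + v) = dot w u + dot w v.
Proof. by move=> *; rewrite dotC dotDl// ![dot _ w]dotC. Qed.

Lemma dotZr a u v : L2 u -> L2 v -> dot v (a *: u) = a * dot v u.
Proof. by move=> *; rewrite dotC dotZl// dotC. Qed.

Lemma dot_suml (I : Type) (r : seq I) (F : I -> 'rV[R]_d -> R) w :
  (forall i, L2 (F i)) -> L2 w -> dot (\sum_(i <- r) F i) w = \sum_(i <- r) dot (F i) w.
Proof.
move=> LF Lw; elim: r => [|i r IHr]; first by rewrite !big_nil dot0l.
by rewrite !big_cons dotDl ?IHr//; exact: L2_sum.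
Qed.

Lemma sqnorm_ge0 u : 0 <= sqnorm u.
Proof. by apply: Rintegral_ge0 => x _; rewrite -expr2 sqr_ge0. Qed.

Lemma sqnormD u v : L2 u -> L2 v -> sqnorm (u + v) = sqnorm u + 2 * dot u v + sqnorm v.
Proof.
move=> Lu Lv; have Luv := L2D Lu Lv.
by rewrite /sqnorm dotDl// !dotDr// [dot v u]dotC; ring.
Qed.

Lemma sqnormZ a u : L2 u -> sqnorm (a *: u) = a ^+ 2 * sqnorm u.
Proof.
by move=> Lu; rewrite /sqnorm dotZl ?dotZr//; [rewrite mulrA expr2|exact: L2Z].
Qed.

Lemma sqnormB u v : L2 u -> L2 v -> sqnorm (u - v) = sqnorm u - 2 * dot u v + sqnorm v.
Proof.
move=> Lu Lv; have LNv := L2Z (-1) Lv.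
by rewrite -scaleN1r sqnormD// sqnormZ// dotZr//; ring.
Qed.

Lemma sqnormD_le u v : L2 u -> L2 v -> sqnorm (u + v) <= 2 * (sqnorm u + sqnorm v).
Proof.
move=> Lu Lv; have := sqnorm_ge0 (u - v).
by rewrite sqnormB// sqnormD//; lra.
Qed.

(** When |v| = 0 the quadratic polynomial a -> |u - a v|^2 is affine and
nonnegative, hence constant; otherwise it is evaluated at its minimum. *)
Lemma cauchy_schwarz u v : L2 u -> L2 v -> dot u v ^+ 2 <= sqnorm u * sqnorm v.
Proof.
move=> Lu Lv; have key a : 0 <= sqnorm u - 2 * a * dot u v + a ^+ 2 * sqnorm v.
  have Lav := L2Z a Lv.
  by have := sqnorm_ge0 (u - a *: v); rewrite sqnormB// sqnormZ// dotZr// mulrA.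
have := sqnorm_ge0 v; rewrite le_eqVlt => /predU1P[v0|v0].
  have [->|uv0] := eqVneq (dot u v) 0; first by rewrite expr0n/= -v0 mulr0.
  have := key ((sqnorm u + 1) / (2 * dot u v)).
  rewrite -v0 !mulr0 addr0.
  set b := dot u v in uv0 *.
  have -> : 2 * ((sqnorm u + 1) / (2 * b)) * b = sqnorm u + 1 by field.
  by move=> H; exfalso; lra.
have := key (dot u v / sqnorm v).
have -> : sqnorm u - 2 * (dot u v / sqnorm v) * dot u v + (dot u v / sqnorm v) ^+ 2 * sqnorm v
  = (sqnorm u * sqnorm v - dot u v ^+ 2) / sqnorm v by field; rewrite gt_eqF.
by rewrite pmulr_lge0 ?invr_gt0// subr_ge0.
Qed.

(** Elements of L^2 being functions and not classes, sqnorm (u - v) = 0 plays the part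
of equality almost everywhere; scalar products do not distinguish such u and v. *)
Lemma null_dot u v : L2 u -> L2 v -> sqnorm u = 0 -> dot u v = 0.
Proof.
move=> Lu Lv u0; have := cauchy_schwarz Lu Lv; rewrite u0 mul0r => uv.
by apply/eqP; rewrite -sqrf_eq0 eq_le uv sqr_ge0.
Qed.

Lemma null_dotr u v : L2 u -> L2 v -> sqnorm u = 0 -> dot v u = 0.
Proof. by move=> *; rewrite dotC null_dot. Qed.

Lemma nullB_dotl u v w : L2 u -> L2 v -> L2 w -> sqnorm (u - v) = 0 -> dot u w = dot v w.
Proof.
move=> Lu Lv Lw uv0; apply/eqP; rewrite -subr_eq0 -dotBl//; apply/eqP.
by apply: null_dot => //; exact: L2B.
Qed.

Lemma bounded_L2 u (C : R) a b : Omega `<=` closed_box a b ->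
  measurable_fun Omega u -> (forall x, Omega x -> `|u x| <= C) -> L2 u.
Proof.
move=> Oab mu_ uC; split=> //.
have := integrableS measurableT mO (@subsetT _ _) (@integrable_cst_box R d (C ^+ 2) a b).
apply: le_integrable => //; first by apply/measurable_EFinP; exact: measurable_funX.
move=> x Ox; rewrite /= lee_fin indicE mem_set ?mulr1; last exact: Oab.
by rewrite !normrX ler_pXn2r// ?nnegrE//= (le_trans (uC _ Ox))// ler_norm.
Qed.

Lemma continuous_L2 u : bounded_set Omega -> continuous u -> L2 u.
Proof.
move=> /bounded_sub_box[M _ OM] cu.
have /compact_bounded/pinfty_ex_gt0[C C0 fC] : compact (u @` closed_box (fun=> - M) (fun=> M)).
  apply: continuous_compact; last exact: closed_box_compact.
  exact: continuous_subspaceT.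
apply: (bounded_L2 OM (C := C)); first exact: continuous_measurable_rV.
by move=> x Ox; apply: fC; exists x => //; exact: OM.
Qed.

End L2_space.

(** * The fundamental lemma of the calculus of variations *)

Section vanishing_integrals.
Context (d : measure_display) (T : measurableType d) (R : realType).
Variable mu : {measure set T -> \bar R}.
Local Open Scope ereal_scope.

(** The sets E for which the integral over the intersection of B and E vanishes form
a Dynkin system, so they are all the measurable sets. *)
Lemma ae_eq0_integral_generator (G : set_system T) (B : set T) (g : T -> \bar R) :
  @measurable _ T = <<s G >> -> setI_closed G -> measurable B -> mu.-integrable B g ->
  \int[mu]_(x in B) g x = 0 ->
  (forall E, G E -> \int[mu]_(x in B `&` E) g x = 0) ->
  ae_eq mu B g (cst 0).
Proof.
move=> mG GI mB ig IB0 IG0.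
have mg := measurable_int _ ig.
have all0 E : measurable E -> \int[mu]_(x in B `&` E) g x = 0.
  rewrite mG; move: E.
  apply: (@dynkin_induction _ _ G (fun E => \int[mu]_(x in B `&` E) g x = 0)) => //.
  - by rewrite setIT.
  - move=> S mS IS0; have mBS := measurableI _ _ mB mS.
    have mBC := measurableI _ _ mB (measurableC mS).
    have := @integral_setU _ _ _ mu _ _ g mBS mBC.
    rewrite -setIUr setUv setIT => /(_ mg).
    rewrite IB0 IS0 add0e => <- //.
    by apply/disj_setPS => x [[_ ?] [_ ]].
  - move=> F mF tF IF0; rewrite setI_bigcupr integral_bigcup.
    + by rewrite eseries0// => n _ _.
    + exact: trivIset_setIl.
    + by move=> k; exact: measurableI.
    + rewrite -setI_bigcupr; apply: integrableS ig => //.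
      by apply: measurableI => //; exact: bigcupT_measurable.
apply: integral_ae_eq => // E EB mE.
by rewrite -(setIidr EB) all0// integral0.
Qed.

End vanishing_integrals.

Section fundamental_lemma.
Context (R : realType) (d : nat) (Omega : set 'rV[R]_d).
Hypothesis oO : open Omega.
Implicit Types (g : 'rV[R]_d -> R) (a b : 'I_d -> R).

Local Notation mu := (lebesgue_rV R d).
Local Notation dot := (L2_dot Omega).
Local Notation sqnorm := (L2_sqnorm Omega).

Let mO : measurable Omega := open_measurable_rV oO.

Definition open_boxes : set_system 'rV[R]_d := [set A | exists a b, A = open_box a b].

Lemma open_boxI a b a' b' : open_box a b `&` open_box a' b' =
  open_box (fun i => Num.max (a i) (a' i)) (fun i => Num.min (b i) (b' i)).
Proof.
apply/seteqP; split=> x.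
  move=> [xab xab'] i; have /andP[? ?] := xab i; have /andP[? ?] := xab' i.
  by rewrite gt_max lt_min; apply/andP; split; apply/andP.
move=> H; split=> i; have := H i; rewrite gt_max lt_min.
  by move=> /andP[/andP[? ?] /andP[? ?]]; apply/andP.
by move=> /andP[/andP[? ?] /andP[? ?]]; apply/andP.
Qed.

Lemma measurable_rV_open_boxes : @measurable _ 'rV[R]_d = <<s open_boxes >>.
Proof.
apply/seteqP; split; last first.
  apply: smallest_sub; first exact: sigma_algebra_measurable.
  by move=> _ [a [b ->]]; exact: measurable_open_box.
have open_sub A : open A -> <<s open_boxes >> A.
  move=> /open_bigcup_box[P [a [b [_ ->]]]].
  apply: (@bigcup_measurable _ (g_sigma_algebraType open_boxes)) => n _.
  by apply: sub_sigma_algebra; exists (a n), (b n).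
apply: smallest_sub; first exact: smallest_sigma_algebra.
move=> A; rewrite -bigcup_seq/= => -[i _ [Y mY <-]]; rewrite setTI.
have mi : measurable_fun [set: g_sigma_algebraType open_boxes]
    (@rV_coord R d i : g_sigma_algebraType open_boxes -> R).
  apply: (measurability _ (measurable_realfun.RGenOpens.measurableE R)).
  move=> _ [_ [s [t ->] <-]]; rewrite setTI; apply: open_sub.
  have /continuousP := @coord_continuous R 1 d ord0 i.
  by apply; exact: interval_open.
by have := mi measurableT Y mY; rewrite setTI.
Qed.

(** Dominated convergence along the bump functions, which increase to the indicator of
the box. *)
Lemma orthogonal_test_integral_box g a b : L2 Omega g ->
  (forall phi, test_function Omega phi -> dot g phi = 0) ->
  closed_box a b `<=` Omega ->
  mu.-integrable (open_box a b) (EFin \o g) /\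
  (\int[mu]_(x in open_box a b) g x)%R = 0.
Proof.
move=> Lg g0 abO.
have mB := measurable_open_box a b.
have BO : open_box a b `<=` Omega.
  by move=> x xab; apply: abO => i; have /andP[? ?] := xab i; rewrite !ltW.
pose I x : R := (x \in open_box a b)%:R.
have mg := Lg.1.
(* Dominates g c for 0 <= c <= 1 supported in the box, as |g| <= g^2 + 1. *)
pose h (x : 'rV[R]_d) : R := g x ^+ 2 + 1 * \1_(closed_box a b) x.
have ih : mu.-integrable Omega (EFin \o h).
  have := integrableD mO Lg.2
    (integrableS measurableT mO (@subsetT _ _) (integrable_cst_box 1 a b)).
  by apply: eq_integrable => // x _; rewrite /= EFinD.
have mh n : measurable_fun Omega (fun x => g x * bump n a b x).
  apply: measurable_funM => //; apply: continuous_measurable_rV => // x.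
  by apply: smooth_continuous; exact: smooth_bump.
have mI : measurable_fun Omega (fun x => g x * I x).
  apply: measurable_funM => //; apply: measurable_funTS.
  exact: measurable_indic.
have le_h (c : R) x : 0 <= c <= 1 -> (~ open_box a b x -> c = 0) -> `|g x * c| <= h x.
  move=> /andP[c0 c1] cB.
  have [xB|xB] := pselect (open_box a b x); last first.
    by rewrite cB// mulr0 normr0 addr_ge0 ?sqr_ge0// mul1r.
  have xC : closed_box a b x by move=> i; have /andP[? ?] := xB i; rewrite !ltW.
  rewrite normrM (ger0_norm c0) (@le_trans _ _ `|g x|) ?ler_piMr//.
  rewrite /h mul1r indicE mem_set//= -real_normK ?num_real//.
  by have := sqr_ge0 (`|g x| - 1); nra.
have cI x : Omega x -> g x * bump n a b x @[n --> \oo] --> g x * I x.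
  by move=> _; apply: cvgM; [exact: cvg_cst|exact: bump_cvg].
have := Rintegral_dominated_cvg mO mh mI ih cI
  (fun n x _ => le_h _ _ (bump_itv n a b x) (@bump_out R d n a b x)).
rewrite (_ : (fun n => _) = cst 0); last first.
  by apply/funext => n; apply: g0; exact: test_bump.
move=> /cvg_lim I0.
have iI : mu.-integrable Omega (EFin \o (fun x => g x * I x)).
  apply: le_integrable ih => //; first exact/measurable_EFinP.
  move=> x Ox; rewrite lee_fin (le_trans (le_h (I x) x _ _)) ?ler_norm//.
    by rewrite /I; case: (_ \in _); rewrite ?lexx ?ler01.
  by rewrite /I; case: (boolP (x \in _)) => // /set_mem.
split.
  have := integrableS mO mB BO iI; apply: eq_integrable => // x /set_mem xB.
  by rewrite /= /I mem_set// mulr1.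
rewrite Rintegral_mkcond.
have -> : g \_ (open_box a b) = (fun x => g x * I x) \_ Omega.
  apply/funext => x; rewrite !patchE /I; case: ifPn => xB.
    by rewrite mem_set ?mulr1//; exact/BO/set_mem.
  by rewrite mulr0 if_same.
by rewrite -Rintegral_mkcond -I0// lim_cst.
Qed.

(** Only 0 is orthogonal to all test functions: the integrals over boxes vanish, hence
g vanishes almost everywhere on each box with closure in Omega, and countably many
of these cover Omega. *)
Lemma orthogonal_test_null g : L2 Omega g ->
  (forall phi, test_function Omega phi -> dot g phi = 0) -> sqnorm g = 0.
Proof.
move=> Lg g0.
have box0 a b : closed_box a b `<=` Omega -> ae_eq mu (open_box a b) (EFin \o g) (cst 0%E).
  move=> abO; have [ig Ig] := orthogonal_test_integral_box Lg g0 abO.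
  have E0 a' b' : closed_box a' b' `<=` Omega ->
      (\int[mu]_(x in open_box a' b') (g x)%:E = 0)%E.
    move=> abO'; have [ig' Ig'] := orthogonal_test_integral_box Lg g0 abO'.
    rewrite -[LHS]fineK; first by rewrite -/(Rintegral _ _ _) Ig'.
    exact: (integrable_fin_num (measurable_open_box a' b') ig').
  apply: (ae_eq0_integral_generator measurable_rV_open_boxes) => //.
  - by move=> _ _ [a1 [b1 ->]] [a2 [b2 ->]]; rewrite open_boxI; do 2 eexists.
  - exact: measurable_open_box.
  - exact: E0.
  - move=> _ [a' [b' ->]]; rewrite open_boxI; apply: E0 => x xab; apply: abO => i.
    by have := xab i; rewrite ge_max le_min => /andP[/andP[-> _] /andP[-> _]].
have [P [a [b [abO EO]]]] := open_bigcup_box oO.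
have g_ae : ae_eq mu Omega (EFin \o (fun x => g x * g x)) (cst 0%E).
  pose F n := if n \in P then [set x | ~ (open_box (a n) (b n) x -> (g x)%:E = 0%E)] else set0.
  have : mu.-negligible (\bigcup_n F n).
    apply: negligible_bigcup => n; rewrite /F; case: ifPn => [/set_mem Pn|_].
      exact: (box0 (a n) (b n) (abO n Pn)).
    exact: negligible_set0.
  apply: negligibleS => x /= /not_implyP[+ gx]; rewrite {1}EO => -[n Pn xab].
  exists n => //; rewrite /F mem_set//= => /(_ xab)[g0x]; apply: gx.
  by rewrite g0x mulr0.
rewrite /L2_sqnorm /L2_dot /Rintegral.
have mgg : measurable_fun Omega (EFin \o (fun x => g x * g x)).
  by apply/measurable_EFinP; apply: measurable_funM; exact: Lg.1.
rewrite (@ae_eq_integral _ _ _ mu Omega (cst 0%E) _ mO mgg (measurable_cst _) g_ae).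
by rewrite integral0.
Qed.

End fundamental_lemma.

(** * Weak derivatives and the Hessian form *)

Lemma le_term_sum (R : realDomainType) (n : nat) (F : 'I_n -> R) (i : 'I_n) :
  (forall j, 0 <= F j) -> F i <= \sum_(j < n) F j.
Proof. by move=> F0; rewrite (bigD1 i)//= lerDl sumr_ge0. Qed.

Section sobolev.
Context (R : realType) (d : nat) (Omega : set 'rV[R]_d).
Hypotheses (oO : open Omega) (bO : bounded_set Omega).
Implicit Types (u v w g h phi : 'rV[R]_d -> R) (s : seq 'I_d) (i j : 'I_d).

Local Notation e_ i := (delta_mx 0 i : 'rV[R]_d).
Local Notation mu := (lebesgue_rV R d).
Local Notation dot := (L2_dot Omega).
Local Notation sqnorm := (L2_sqnorm Omega).
Local Notation L2 := (L2 Omega).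
Local Notation test := (test_function Omega).
Local Notation H2 := (H2 Omega).
Local Notation wp := (weak_partial Omega).
Local Notation wps := (weak_partials_in_L2 Omega).
Local Notation hess := (hessian_form Omega).

Let mO : measurable Omega := open_measurable_rV oO.

Lemma smooth_L2 u : smooth u -> L2 u.
Proof. by move=> su; apply: continuous_L2 => // x; exact: smooth_continuous. Qed.

Lemma test_L2 phi : test phi -> L2 phi.
Proof. by move=> /test_smooth/smooth_L2. Qed.

Lemma weak_partials_unique s u g h : wps s u g -> wps s u h -> sqnorm (g - h) = 0.
Proof.
move=> [Lg ug] [Lh uh]; apply: (orthogonal_test_null oO); first exact: L2B.
move=> phi tphi; have Lphi := test_L2 tphi; rewrite dotBl//; apply/eqP.
have := ug _ tphi; rewrite (uh _ tphi) => /(congr1 ( *%R ((-1) ^+ size s))).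
by rewrite !mulrA -expr2 sqrr_sign !mul1r => ->; rewrite subrr.
Qed.

Lemma weak_partialsD s u v g h : L2 u -> L2 v -> wps s u g -> wps s v h ->
  wps s (u + v) (g + h).
Proof.
move=> Lu Lv [Lg ug] [Lh vh]; split; first exact: L2D.
move=> phi tphi; have Lphi := test_L2 tphi.
have Lsphi := test_L2 (test_iter_partial s tphi).
by rewrite !dotDl// ug// vh// mulrDr.
Qed.

Lemma weak_partialsZ s a u g : L2 u -> wps s u g -> wps s (a *: u) (a *: g).
Proof.
move=> Lu [Lg ug]; split; first exact: L2Z.
move=> phi tphi; have Lphi := test_L2 tphi.
have Lsphi := test_L2 (test_iter_partial s tphi).
by rewrite !dotZl// ug// mulrCA.
Qed.

Lemma weak_partialsB s u v g h : L2 u -> L2 v -> wps s u g -> wps s v h ->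
  wps s (u - v) (g - h).
Proof.
move=> Lu Lv ug vh; have Nvh := weak_partialsZ (-1) Lv vh.
rewrite !scaleN1r in Nvh; apply: weak_partialsD => //.
by rewrite -scaleN1r; exact: L2Z.
Qed.

Lemma weak_partials_smooth s u : smooth u -> wps s u (iter_partial (rev s) u).
Proof.
move=> su; split; first by apply: smooth_L2; exact: smooth_iter_partial.
by move=> phi tphi; exact: smooth_dot_iter_partial.
Qed.

(** A null function has 0 among its weak derivatives, so that null functions are
negligible for the Hessian form as well. *)
Lemma weak_partials_null s u : L2 u -> sqnorm u = 0 -> wps s u 0.
Proof.
move=> Lu u0; split; first exact: L2_0.
move=> phi tphi; have Lsphi := test_L2 (test_iter_partial s tphi).
by rewrite null_dot// dot0l// mulr0.
Qed.

Lemma H2_L2 u : H2 u -> L2 u. Proof. by case. Qed.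

Lemma weak_partialP s u : (size s <= 2)%N -> H2 u -> wps s u (wp s u).
Proof. by move=> s2 [_ /(_ s s2)]; exact: xgetPex. Qed.

Lemma weak_partial_L2 s u : (size s <= 2)%N -> H2 u -> L2 (wp s u).
Proof. by move=> s2 /(weak_partialP s2)[]. Qed.

Lemma weak_partial_nullB s u g : (size s <= 2)%N -> H2 u -> wps s u g ->
  sqnorm (wp s u - g) = 0.
Proof. by move=> s2 Hu ug; apply: weak_partials_unique ug; exact: weak_partialP. Qed.

(** The chosen weak derivative may be replaced by any other one inside a scalar
product. *)
Lemma weak_partial_dot s u g w : (size s <= 2)%N -> H2 u -> wps s u g -> L2 w ->
  dot (wp s u) w = dot g w.
Proof.
move=> s2 Hu ug Lw; apply: nullB_dotl => //; first exact: weak_partial_L2.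
  exact: ug.1.
exact: weak_partial_nullB.
Qed.

Lemma weak_partial_sqnorm s u g : (size s <= 2)%N -> H2 u -> wps s u g ->
  sqnorm (wp s u) = sqnorm g.
Proof.
move=> s2 Hu ug; have Lg := ug.1; have Lwp := weak_partial_L2 s2 Hu.
by rewrite /L2_sqnorm (weak_partial_dot s2 Hu ug)// dotC (weak_partial_dot s2 Hu ug).
Qed.

Lemma H2D u v : H2 u -> H2 v -> H2 (u + v).
Proof.
move=> Hu Hv; split; first by apply: L2D => //; exact: H2_L2.
move=> s s2; exists (wp s u + wp s v).
by apply: weak_partialsD; [exact: H2_L2|exact: H2_L2|exact: weak_partialP|exact: weak_partialP].
Qed.

Lemma H2Z a u : H2 u -> H2 (a *: u).
Proof.
move=> Hu; split; first by apply: L2Z => //; exact: H2_L2.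
move=> s s2; exists (a *: wp s u).
by apply: weak_partialsZ; [exact: H2_L2|exact: weak_partialP].
Qed.

Lemma H2B u v : H2 u -> H2 v -> H2 (u - v).
Proof. by move=> Hu Hv; rewrite -scaleN1r; apply: H2D => //; exact: H2Z. Qed.

Lemma H2_smooth u : smooth u -> H2 u.
Proof.
move=> su; split; first exact: smooth_L2.
by move=> s _; exists (iter_partial (rev s) u); exact: weak_partials_smooth.
Qed.

Lemma H2_sum (I : Type) (r : seq I) (F : I -> 'rV[R]_d -> R) :
  (forall k, H2 (F k)) -> H2 (\sum_(k <- r) F k).
Proof.
move=> HF; elim: r => [|k r IHr]; last by rewrite big_cons; exact: H2D.
by rewrite big_nil; apply: H2_smooth; exact: (@smooth_cst _ _ 0).
Qed.

Lemma hessC u v : hess u v = hess v u.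
Proof. by apply: eq_bigr => i _; apply: eq_bigr => j _; exact: dotC. Qed.

Lemma hessDl u v w : H2 u -> H2 v -> H2 w -> hess (u + v) w = hess u w + hess v w.
Proof.
move=> Hu Hv Hw; rewrite /hessian_form -big_split; apply: eq_bigr => i _.
rewrite -big_split; apply: eq_bigr => j _ /=.
have s2 : (size [:: i; j] <= 2)%N by [].
have Pu := weak_partialP s2 Hu; have Pv := weak_partialP s2 Hv.
have Lw := weak_partial_L2 s2 Hw.
rewrite (weak_partial_dot s2 (H2D Hu Hv) (weak_partialsD (H2_L2 Hu) (H2_L2 Hv) Pu Pv) Lw).
exact: (dotDl mO Pu.1 Pv.1 Lw).
Qed.

Lemma hessZl a u w : H2 u -> H2 w -> hess (a *: u) w = a * hess u w.
Proof.
move=> Hu Hw; rewrite /hessian_form mulr_sumr; apply: eq_bigr => i _.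
rewrite mulr_sumr; apply: eq_bigr => j _ /=.
have s2 : (size [:: i; j] <= 2)%N by [].
have Pu := weak_partialP s2 Hu; have Lw := weak_partial_L2 s2 Hw.
rewrite (weak_partial_dot s2 (H2Z a Hu) (weak_partialsZ a (H2_L2 Hu) Pu) Lw).
exact: (dotZl mO a Pu.1 Lw).
Qed.

Lemma hessDr u v w : H2 u -> H2 v -> H2 w -> hess w (u + v) = hess w u + hess w v.
Proof. by move=> Hu Hv Hw; rewrite hessC (hessDl Hu Hv Hw) (hessC u) (hessC v). Qed.

Lemma hessZr a u w : H2 u -> H2 w -> hess w (a *: u) = a * hess w u.
Proof. by move=> Hu Hw; rewrite hessC (hessZl a Hu Hw) (hessC u). Qed.

Lemma hess0l w : H2 w -> hess 0 w = 0.
Proof.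
move=> Hw; have H0 : H2 0 by apply: H2_smooth; exact: (@smooth_cst _ _ 0).
by rewrite -(scale0r (0 : 'rV[R]_d -> R)) (hessZl 0 H0 Hw) mul0r.
Qed.

Lemma hess_suml (I : Type) (r : seq I) (F : I -> 'rV[R]_d -> R) w :
  (forall k, H2 (F k)) -> H2 w -> hess (\sum_(k <- r) F k) w = \sum_(k <- r) hess (F k) w.
Proof.
move=> HF Hw; elim: r => [|k r IHr]; first by rewrite !big_nil hess0l.
by rewrite !big_cons (hessDl (HF k) (H2_sum r HF) Hw) IHr.
Qed.

Lemma hess_ge0 u : 0 <= hess u u.
Proof. by apply: sumr_ge0 => i _; apply: sumr_ge0 => j _; exact: sqnorm_ge0. Qed.

Lemma le_weak_partial_hess i j u : sqnorm (wp [:: i; j] u) <= hess u u.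
Proof.
pose F k l := sqnorm (wp [:: k; l] u).
have F0 k l : 0 <= F k l by exact: sqnorm_ge0.
apply: le_trans (le_term_sum j (F0 i)) _.
apply: (le_term_sum (F := fun k => \sum_(l < d) F k l) i) => k.
by apply: sumr_ge0 => l _; exact: F0.
Qed.

Lemma hess_smooth u v : H2 u -> smooth v ->
  hess u v = \sum_(i < d) \sum_(j < d) dot (wp [:: i; j] u) ('D_(e_ j) ('D_(e_ i) v)).
Proof.
move=> Hu sv; apply: eq_bigr => i _; apply: eq_bigr => j _; rewrite dotC [RHS]dotC.
have s2 : (size [:: i; j] <= 2)%N by [].
apply: (weak_partial_dot s2 (H2_smooth sv) (weak_partials_smooth _ sv)).
exact: weak_partial_L2.
Qed.

End sobolev.

(** * Approximation by test functions *)

Section null_sequences.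
Context (R : realType).

Lemma squeeze0 (x y : nat -> R) : (forall n, 0 <= x n <= y n) ->
  y n @[n --> \oo] --> (0 : R) -> x n @[n --> \oo] --> (0 : R).
Proof.
move=> xy y0; apply: (@squeeze_cvgr _ _ _ _ (cst 0) y) => //; last exact: cvg_cst.
exact: nearW.
Qed.

Lemma cvg0Z (a : R) (x : nat -> R) : x n @[n --> \oo] --> (0 : R) ->
  a * x n @[n --> \oo] --> (0 : R).
Proof.
by move=> x0; rewrite -[X in _ --> X](mulr0 a); apply: cvgM; [exact: cvg_cst|].
Qed.

Lemma cvg0D (x y : nat -> R) : x n @[n --> \oo] --> (0 : R) -> y n @[n --> \oo] --> (0 : R) ->
  2 * (x n + y n) @[n --> \oo] --> (0 : R).
Proof.
move=> x0 y0; apply: cvg0Z.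
by rewrite -[X in _ --> X](addr0 (0 : R)); exact: cvgD.
Qed.

Lemma cvg0_sum m (F : 'I_m -> nat -> R) : (forall k, F k n @[n --> \oo] --> (0 : R)) ->
  \sum_(k < m) F k n @[n --> \oo] --> (0 : R).
Proof.
move=> F0; have : \sum_(k < m) F k n @[n --> \oo] --> (\sum_(k < m) (0 : R)).
  by apply: cvg_big => [|k _]; [exact: add_continuous|exact: F0].
by rewrite big1_eq.
Qed.

End null_sequences.

Section dirichlet_space.
Context (R : realType) (d : nat) (Omega : set 'rV[R]_d).
Hypotheses (oO : open Omega) (bO : bounded_set Omega).
Implicit Types (u v w g h phi : 'rV[R]_d -> R) (s : seq 'I_d) (i j : 'I_d).

Local Notation e_ i := (delta_mx 0 i : 'rV[R]_d).
Local Notation mu := (lebesgue_rV R d).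
Local Notation dot := (L2_dot Omega).
Local Notation sqnorm := (L2_sqnorm Omega).
Local Notation L2 := (L2 Omega).
Local Notation test := (test_function Omega).
Local Notation H2 := (H2 Omega).
Local Notation wp := (weak_partial Omega).
Local Notation wps := (weak_partials_in_L2 Omega).
Local Notation hess := (hessian_form Omega).

Let mO : measurable Omega := open_measurable_rV oO.

(** What membership in H^2_0 is used for; stated with some weak derivatives g rather
than the chosen ones, it is visibly stable under linear combinations. *)
Definition test_approximable u : Prop := exists phi_ : nat -> 'rV[R]_d -> R,
  [/\ forall n, test (phi_ n),
      sqnorm (u - phi_ n) @[n --> \oo] --> (0 : R) &
      forall i j, exists2 g, wps [:: i; j] u g &
        sqnorm (g - 'D_(e_ j) ('D_(e_ i) (phi_ n))) @[n --> \oo] --> (0 : R)].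

Lemma H20_approximable u : H20 Omega u -> test_approximable u.
Proof.
move=> [Hu u_test].
have /choice[phi_ phiP] : forall n, exists phi,
    test phi /\ H2_sqnorm Omega (u - phi) < n.+1%:R^-1.
  move=> n; have [phi tphi uphi] := u_test n.+1%:R^-1 (eqbRL (invr_gt0 _) (ltr0Sn _ _)).
  by exists phi.
have tphi n : test (phi_ n) := (phiP n).1.
have Hphi n : H2 (phi_ n) by exact: (H2_smooth oO bO (test_smooth (tphi n))).
exists phi_; split=> // [|i j].
  apply: (squeeze0 (y := harmonic)) => [n|]; last exact: cvg_harmonic.
  rewrite sqnorm_ge0//=; apply: le_trans (ltW (phiP n).2).
  rewrite /H2_sqnorm -addrA lerDl addr_ge0//; apply: sumr_ge0 => i _; first exact: sqnorm_ge0.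
  by apply: sumr_ge0 => j _; exact: sqnorm_ge0.
have s2 : (size [:: i; j] <= 2)%N by [].
exists (wp [:: i; j] u); first exact: weak_partialP.
apply: (squeeze0 (y := harmonic)) => [n|]; last exact: cvg_harmonic.
rewrite sqnorm_ge0//=; apply: le_trans (ltW (phiP n).2).
have Hn := H2B oO bO Hu (Hphi n).
have Pn := weak_partialsB oO bO (H2_L2 Hu) (H2_L2 (Hphi n)) (weak_partialP s2 Hu)
  (weak_partials_smooth oO bO [:: i; j] (test_smooth (tphi n))).
have E := weak_partial_sqnorm oO bO s2 Hn Pn.
rewrite [leLHS](esym E).
apply: le_trans (le_weak_partial_hess Omega i j (u - phi_ n)) _.
rewrite /H2_sqnorm lerDr addr_ge0 ?sqnorm_ge0//.
by apply: sumr_ge0 => l _; exact: sqnorm_ge0.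
Qed.

Lemma testD phi psi : test phi -> test psi -> test (phi + psi).
Proof.
move=> [sp [K [cK KO] pK]] [sq [K' [cK' KO'] qK']]; split; first exact: smoothD.
exists (K `|` K'); first by split; [exact: compactU|rewrite subUset].
move=> x /not_orP[/pK px /qK' qx].
have -> : (phi + psi) x = phi x + psi x by [].
by rewrite px qx addr0.
Qed.

Lemma testZ a phi : test phi -> test (a *: phi).
Proof. by move=> tphi; exact: (smooth_mul_test (smooth_cst a) tphi). Qed.

Lemma approximableD u v : L2 u -> L2 v -> test_approximable u -> test_approximable v ->
  test_approximable (u + v).
Proof.
move=> Lu Lv [phi_ [tphi uphi wuphi]] [psi_ [tpsi vpsi wvpsi]].
have Lphi n := test_L2 oO bO (tphi n); have Lpsi n := test_L2 oO bO (tpsi n).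
exists (fun n => phi_ n + psi_ n); split=> [n||i j]; first exact: testD.
  apply: squeeze0 (cvg0D uphi vpsi) => n; rewrite sqnorm_ge0/= opprD addrACA.
  exact: (sqnormD_le mO (L2B mO Lu (Lphi n)) (L2B mO Lv (Lpsi n))).
have [g ug gphi] := wuphi i j; have [h vh hpsi] := wvpsi i j.
exists (g + h); first exact: (weak_partialsD oO bO Lu Lv ug vh).
apply: squeeze0 (cvg0D gphi hpsi) => n; rewrite sqnorm_ge0/=.
have sphi := test_smooth (tphi n); have spsi := test_smooth (tpsi n).
have LDphi := smooth_L2 oO bO (smooth_partial j (smooth_partial i sphi)).
have LDpsi := smooth_L2 oO bO (smooth_partial j (smooth_partial i spsi)).
rewrite [phi_ n + psi_ n]/(phi_ n \+ psi_ n) (partialD i sphi spsi).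
rewrite (partialD j (smooth_partial i sphi) (smooth_partial i spsi)).
rewrite [X in g + h - X]/('D_(e_ j) ('D_(e_ i) (phi_ n))
  + 'D_(e_ j) ('D_(e_ i) (psi_ n)) : 'rV[R]_d -> R).
rewrite opprD addrACA.
exact: (sqnormD_le mO (L2B mO ug.1 LDphi) (L2B mO vh.1 LDpsi)).
Qed.

Lemma approximableZ a u : L2 u -> test_approximable u -> test_approximable (a *: u).
Proof.
move=> Lu [phi_ [tphi uphi wuphi]].
have Lphi n := test_L2 oO bO (tphi n).
exists (fun n => a *: phi_ n); split=> [n||i j]; first exact: testZ.
  apply: squeeze0 (cvg0Z (a ^+ 2) uphi) => n; rewrite sqnorm_ge0/= -scalerBr.
  by rewrite (sqnormZ mO a (L2B mO Lu (Lphi n))).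
have [g ug gphi] := wuphi i j.
exists (a *: g); first exact: (weak_partialsZ oO bO a Lu ug).
apply: squeeze0 (cvg0Z (a ^+ 2) gphi) => n; rewrite sqnorm_ge0/=.
have sphi := test_smooth (tphi n).
have LDphi := smooth_L2 oO bO (smooth_partial j (smooth_partial i sphi)).
rewrite [a *: phi_ n]/(a \*o phi_ n) (partialZ i a sphi).
rewrite (partialZ j a (smooth_partial i sphi)).
rewrite [X in a *: g - X]/(a *: ('D_(e_ j) ('D_(e_ i) (phi_ n)) : 'rV[R]_d -> R)).
by rewrite -scalerBr (sqnormZ mO a (L2B mO ug.1 LDphi)).
Qed.

Lemma approximable0 : test_approximable 0.
Proof.
have t0 : test 0.
  split; first exact: (@smooth_cst _ _ 0).
  by exists set0 => //; split => //; exact: compact0.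
have D0 i : 'D_(e_ i) (0 : 'rV[R]_d -> R) = 0.
  by apply/funext => x; exact: derive_cst.
have DD0 i j : 'D_(e_ j) ('D_(e_ i) (0 : 'rV[R]_d -> R)) = 0.
  exact: (etrans (congr1 (fun f => 'D_(e_ j) f) (D0 i)) (D0 j)).
have S0 : sqnorm 0 = 0 by rewrite /L2_sqnorm dot0l.
exists (fun=> 0); split=> [n||i j]; first exact: t0.
  by rewrite subr0 S0; exact: cvg_cst.
exists 0; last by rewrite DD0 subr0 S0; exact: cvg_cst.
rewrite -[X in wps _ _ X](DD0 i j).
exact: (weak_partials_smooth oO bO [:: i; j] (test_smooth t0)).
Qed.

Lemma approximable_sum (I : Type) (r : seq I) (F : I -> 'rV[R]_d -> R) :
  (forall k, L2 (F k)) -> (forall k, test_approximable (F k)) ->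
  test_approximable (\sum_(k <- r) F k).
Proof.
move=> LF AF; elim: r => [|k r IHr]; first by rewrite big_nil; exact: approximable0.
rewrite big_cons; apply: approximableD => //; exact: L2_sum.
Qed.

(** Poincare's inequality, applied in the directions i and then j to the approximating
test functions, bounds |u| by a multiple of |d_ij u|. *)
Lemma approximable_null u i j : H2 u -> test_approximable u ->
  sqnorm (wp [:: i; j] u) = 0 -> sqnorm u = 0.
Proof.
move=> Hu [phi_ [tphi uphi wuphi]] wu0.
have Lu := H2_L2 Hu; have Lphi n := test_L2 oO bO (tphi n).
have [M _ OM] := bounded_sub_box bO.
have [g ug gphi] := wuphi i j.
have s2 : (size [:: i; j] <= 2)%N by [].
have g0 : sqnorm g = 0 by rewrite -(weak_partial_sqnorm oO bO s2 Hu ug).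
pose C := 4 * M ^+ 2.
have C0 : 0 <= C by rewrite mulr_ge0// sqr_ge0.
have bound n : sqnorm u <= 2 * (sqnorm (u - phi_ n) + C * (C *
    sqnorm (g - 'D_(e_ j) ('D_(e_ i) (phi_ n))))).
  have LD := smooth_L2 oO bO (smooth_partial j (smooth_partial i (test_smooth (tphi n)))).
  have := sqnormD_le mO (L2B mO Lu (Lphi n)) (Lphi n); rewrite subrK.
  move=> /le_trans; apply; rewrite ler_wpM2l// lerD2l.
  apply: (le_trans (test_poincare i oO OM (tphi n))); rewrite -/C ler_wpM2l//.
  apply: (le_trans (test_poincare j oO OM (test_partial i (tphi n)))); rewrite -/C ler_wpM2l//.
  by rewrite (sqnormB mO ug.1 LD) (null_dot mO ug.1 LD g0) g0 mulr0 subr0 add0r.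
apply/eqP; rewrite eq_le sqnorm_ge0 andbT.
have lim0 := cvg0D uphi (cvg0Z C (cvg0Z C gphi)).
rewrite -(cvg_lim _ lim0)//; apply: limr_ge; first exact: cvgP lim0.
exact: nearW.
Qed.

Lemma null_cvg_dot (g_ : nat -> 'rV[R]_d -> R) w : (forall n, L2 (g_ n)) -> L2 w ->
  sqnorm (g_ n) @[n --> \oo] --> (0 : R) -> dot (g_ n) w @[n --> \oo] --> (0 : R).
Proof.
move=> Lg Lw g0; apply/cvgr0Pnorm_le => e e0.
have w0 := sqnorm_ge0 Omega w.
have H : sqnorm w * sqnorm (g_ n) @[n --> \oo] --> (0 : R) by exact: cvg0Z.
have /cvgr0Pnorm_le/(_ (e ^+ 2)) := H; rewrite exprn_gt0// => /(_ isT).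
apply: filterS => n; rewrite ger0_norm ?mulr_ge0 ?sqnorm_ge0// mulrC => wg.
rewrite -(@ler_pXn2r _ 2)// ?nnegrE ?(ltW e0)// real_normK ?num_real//.
by rewrite (le_trans (cauchy_schwarz mO (Lg n) Lw)).
Qed.

(** If v solves the eigenvalue equation tested against test functions, both sides
being continuous in u for convergence of u and of its second derivatives, it solves
it tested against H^2_0. *)
Lemma approximable_hess u v lam : H2 u -> test_approximable u -> smooth v ->
  (forall phi, test phi -> \sum_(i < d) \sum_(j < d)
     dot ('D_(e_ j) ('D_(e_ i) phi)) ('D_(e_ j) ('D_(e_ i) v)) = lam * dot phi v) ->
  hess u v = lam * dot u v.
Proof.
move=> Hu [phi_ [tphi uphi wuphi]] sv weak_eq.
have Lu := H2_L2 Hu; have Lphi n := test_L2 oO bO (tphi n).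
have Lv := smooth_L2 oO bO sv.
pose Dv i j : 'rV[R]_d -> R := 'D_(e_ j) ('D_(e_ i) v).
pose Dphi n i j : 'rV[R]_d -> R := 'D_(e_ j) ('D_(e_ i) (phi_ n)).
have LDv i j : L2 (Dv i j) := smooth_L2 oO bO (smooth_partial j (smooth_partial i sv)).
have LDphi n i j : L2 (Dphi n i j) :=
  smooth_L2 oO bO (smooth_partial j (smooth_partial i (test_smooth (tphi n)))).
have Lwu i j : L2 (wp [:: i; j] u) by exact: weak_partial_L2.
have c1 i j : dot (wp [:: i; j] u) (Dv i j) - dot (Dphi n i j) (Dv i j)
    @[n --> \oo] --> (0 : R).
  have [g ug gphi] := wuphi i j.
  rewrite (weak_partial_dot oO bO _ Hu ug)//.
  have := null_cvg_dot (fun n => L2B mO ug.1 (LDphi n i j)) (LDv i j) gphi.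
  by under eq_cvg do rewrite (dotBl mO ug.1 (LDphi _ _ _) (LDv _ _)).
have c2 : lam * (dot u v - dot (phi_ n) v) @[n --> \oo] --> (0 : R).
  apply: cvg0Z; have := null_cvg_dot (fun n => L2B mO Lu (Lphi n)) Lv uphi.
  by under eq_cvg do rewrite (dotBl mO Lu (Lphi _) Lv).
have c3 : \sum_(i < d) \sum_(j < d) (dot (wp [:: i; j] u) (Dv i j) - dot (Dphi n i j) (Dv i j))
    @[n --> \oo] --> (0 : R).
  by apply: cvg0_sum => i; apply: cvg0_sum => j.
have key n : hess u v - lam * dot u v = \sum_(i < d) \sum_(j < d)
    (dot (wp [:: i; j] u) (Dv i j) - dot (Dphi n i j) (Dv i j))
      - lam * (dot u v - dot (phi_ n) v).
  rewrite mulrBr opprB -(weak_eq _ (tphi n)) (hess_smooth oO bO Hu sv).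
  under [X in _ = X + _]eq_bigr do rewrite sumrB.
  rewrite sumrB; move: (\sum_(i < d) _) (\sum_(i < d) _) (lam * _) => A B C'; ring.
have c4 : hess u v - lam * dot u v @[n --> \oo] --> (0 : R).
  rewrite -[X in _ --> X](subr0 (0 : R)); under eq_cvg => n do rewrite (key n).
  exact: cvgB c3 c2.
have c5 : hess u v - lam * dot u v @[n --> \oo] --> hess u v - lam * dot u v by exact: cvg_cst.
have := cvg_unique _ c5 c4.
by move=> H; apply/eqP; rewrite -subr_eq0 H.
Qed.

End dirichlet_space.

(** * The plane waves *)

Section separated_waves.
Context (R : realType) (d : nat).
Implicit Types (k c s : R) (i j l : 'I_d) (x : 'rV[R]_d) (a b : 'I_d -> R).

Local Notation e_ i := (delta_mx 0 i : 'rV[R]_d).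

Definition wave k l c s x : R := c * cos (k * x ord0 l) + s * sin (k * x ord0 l).

Lemma is_derive_wave1 k c s (t : R) :
  is_derive t 1 (fun t : R => c * cos (k * t) + s * sin (k * t))
    (k * s * cos (k * t) + - (k * c) * sin (k * t)).
Proof.
have dk : is_derive t 1 (fun t : R => k * t) k.
  by apply: is_derive_eq; rewrite /GRing.scale/= mulr1.
have dc := @is_derive1_comp _ cos (fun t : R => k * t) t _ _ (is_derive_cos (k * t)) dk.
have ds := @is_derive1_comp _ sin (fun t : R => k * t) t _ _ (is_derive_sin (k * t)) dk.
have D := is_deriveD (is_deriveZ c dc) (is_deriveZ s ds).
by apply: (is_derive_eq D); rewrite /GRing.scale/=; ring.
Qed.

Lemma smooth_wave k l c s : smooth (wave k l c s).
Proof.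
apply: (@smooth_coord R d
  [set phi | exists c s, phi = fun t => c * cos (k * t) + s * sin (k * t)] l
  _ (fun t => c * cos (k * t) + s * sin (k * t))); last by exists c, s.
move=> _ [{}c [{}s ->]].
exists (fun t => k * s * cos (k * t) + - (k * c) * sin (k * t)); last exact: is_derive_wave1.
by exists (k * s), (- (k * c)).
Qed.

Lemma partial_wave k l c s i :
  'D_(e_ i) (wave k l c s) = if i == l then wave k l (k * s) (- (k * c)) else 0.
Proof.
apply/funext => x.
have [_ ->] := is_derive_coord i (is_derive_wave1 k c s (x ord0 l)).
by case: eqP => _; rewrite ?mul1r ?mul0r.
Qed.

(** In the trial space all a l with l > 0 are 0: only the first coordinate, on which no
symmetry is imposed, carries a cosine. *)
Definition separated_wave k a b x : R := \sum_(l < d) wave k l (a l) (b l) x.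

Lemma smooth_separated_wave k a b : smooth (separated_wave k a b).
Proof. by apply: smooth_sum => l; exact: smooth_wave. Qed.

Lemma partial_separated_wave k a b i :
  'D_(e_ i) (separated_wave k a b) = wave k i (k * b i) (- (k * a i)).
Proof.
apply/funext => x.
have D l := derivableP (@smooth_derivable _ _ _ i x (smooth_wave k l (a l) (b l))).
have [_] := is_derive_sum D.
rewrite (_ : \sum_(l < d) wave k l (a l) (b l) = separated_wave k a b); last first.
  by apply/funext => y; rewrite fct_sumE.
move=> ->; have Dw l := congr1 (@^~ x) (partial_wave k l (a l) (b l) i).
rewrite (bigD1 i)//= [X in X + _]Dw eqxx big1 ?addr0// => l li.
by rewrite [LHS]Dw eq_sym (negPf li).
Qed.

Lemma partial2_separated_wave k a b i j :
  'D_(e_ j) ('D_(e_ i) (separated_wave k a b)) =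
  if j == i then - k ^+ 2 *: wave k i (a i) (b i) else 0.
Proof.
rewrite (partial_separated_wave k a b i) (partial_wave k i _ _ j); case: eqP => // _.
apply/funext => x; transitivity (- k ^+ 2 * wave k i (a i) (b i) x); last by [].
by rewrite /wave; ring.
Qed.

Lemma partial2_wave k l c s : 'D_(e_ l) ('D_(e_ l) (wave k l c s)) = - k ^+ 2 *: wave k l c s.
Proof.
rewrite (partial_wave k l c s l) eqxx (partial_wave k l (k * s) (- (k * c)) l) eqxx.
apply/funext => x; transitivity (- k ^+ 2 * wave k l c s x); last by [].
by rewrite /wave; ring.
Qed.

End separated_waves.

Section wave_energy.
Context (R : realType) (d : nat) (Omega : set 'rV[R]_d).
Hypotheses (oO : open Omega) (bO : bounded_set Omega).
Hypothesis symO : forall l : 'I_d, (0 < l)%N -> reflection l @` Omega = Omega.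
Implicit Types (k c s : R) (i j l : 'I_d) (x : 'rV[R]_d) (a b : 'I_d -> R).

Local Notation e_ i := (delta_mx 0 i : 'rV[R]_d).
Local Notation mu := (lebesgue_rV R d).
Local Notation dot := (L2_dot Omega).
Local Notation sqnorm := (L2_sqnorm Omega).
Local Notation L2 := (L2 Omega).
Local Notation test := (test_function Omega).
Local Notation H2 := (H2 Omega).
Local Notation wp := (weak_partial Omega).
Local Notation hess := (hessian_form Omega).

Let mO : measurable Omega := open_measurable_rV oO.

Lemma reflectionK l : involutive (@reflection R d l).
Proof. by move=> x; apply/rowP => j; rewrite !mxE; case: eqP; rewrite ?opprK. Qed.

Lemma reflection_preimage l : (0 < l)%N -> reflection l @^-1` Omega = Omega.
Proof.
move=> l0; apply/seteqP; split=> x.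
  by move=> /= Ox; rewrite -(symO l0); exists (reflection l x) => //; rewrite reflectionK.
by rewrite -{1}(symO l0) => -[y Oy <-]; rewrite /= reflectionK.
Qed.

Lemma measure_preserving_reflection l : measure_preserving mu (@reflection R d l).
Proof.
have := @measure_preserving_rV R d (fun j => if j == l then -%R else id).
rewrite (_ : (fun x => _) = reflection l).
  apply=> j; case: eqP => _; first exact: measure_preservingN.
  exact: measure_preserving_id.
by apply/funext => x; apply/rowP => j; rewrite !mxE; case: eqP.
Qed.

Lemma odd_dot0 l (f g : 'rV[R]_d -> R) : (0 < l)%N -> smooth f -> smooth g ->
  (forall x, f (reflection l x) = - f x) -> (forall x, g (reflection l x) = g x) ->
  dot f g = 0.
Proof.
move=> l0 sf sg fN gE.
have sfg := smoothM sf sg.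
have Lf := smooth_L2 oO bO sf; have Lg := smooth_L2 oO bO sg.
have mfg : measurable_fun [set: 'rV[R]_d] (f \* g).
  by apply: continuous_measurable_rV => // x; exact: smooth_continuous.
have ifg : mu.-integrable Omega (EFin \o (f \* g)) by exact: (L2_mul_integrable mO Lf Lg).
have fgN x : (f \* g) (reflection l x) = - 1 * (f \* g) x by rewrite /= fN gE; ring.
have := @Rintegral_measure_preserving _ _ (reflection l) Omega (f \* g)
  (measure_preserving_reflection l) mO mfg.
rewrite (reflection_preimage l0).
rewrite (_ : (f \* g) \o reflection l = (fun x => - 1 * (f \* g) x)); last exact/funext.
move=> /(_ (integrableZl mO (-1) ifg)).
rewrite (@eq_Rintegral _ _ _ mu Omega (fun x => - 1 * (f \* g) x)); last first.
  by move=> x _; exact: fgN.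
rewrite RintegralZl// -[(\int[mu]_(x in Omega) (f \* g) x)%R]/(dot f g).
by move: (dot f g) => D D1; lra.
Qed.

(** Of two distinct coordinates one, say l, is not the first. The wave in x_l is then a
pure sine, odd under the reflection of x_l, and the other wave is even. *)
Lemma wave_dot0 k a b i j : (forall l, (0 < l)%N -> a l = 0) -> i != j ->
  dot (wave k i (a i) (b i)) (wave k j (a j) (b j)) = 0.
Proof.
move=> a0.
wlog i0 : i j / (0 < i)%N.
  move=> H ij; have [i0|i0] := posnP i; last exact: H.
  rewrite dotC; apply: H; last by rewrite eq_sym.
  rewrite lt0n; apply: contra ij => /eqP j0; apply/eqP/val_inj.
  by rewrite /= i0 j0.
move=> ij; apply: (odd_dot0 i0); [exact: smooth_wave|exact: smooth_wave| |] => x.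
  by rewrite /wave !mxE eqxx (a0 _ i0) !mul0r !add0r [k * - _]mulrN sinN mulrN.
by rewrite /wave !mxE eq_sym (negPf ij).
Qed.

Lemma wave_L2 k l c s : L2 (wave k l c s).
Proof. by apply: smooth_L2 => //; exact: smooth_wave. Qed.

Lemma separated_waveE k a b : separated_wave k a b = \sum_(l < d) wave k l (a l) (b l).
Proof. by apply/funext => x; rewrite fct_sumE. Qed.

Lemma separated_wave_sqnorm k a b : (forall l, (0 < l)%N -> a l = 0) ->
  sqnorm (separated_wave k a b) = \sum_(l < d) sqnorm (wave k l (a l) (b l)).
Proof.
move=> a0; rewrite separated_waveE /L2_sqnorm.
have Lw l : L2 (wave k l (a l) (b l)) := wave_L2 k l (a l) (b l).
rewrite (dot_suml mO _ Lw (L2_sum mO _ Lw)); apply: eq_bigr => i _.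
rewrite dotC (dot_suml mO _ Lw (Lw i)) (bigD1 i)//= big1 ?addr0// => j ji.
exact: wave_dot0.
Qed.

(** The second derivatives are d_ii = - k^2 times the wave in x_i, and 0 off the
diagonal; the waves in different coordinates being orthogonal, the sum of the
squares of their norms is that of the total wave. *)
Lemma separated_wave_hess k a b : (forall l, (0 < l)%N -> a l = 0) ->
  hess (separated_wave k a b) (separated_wave k a b) = k ^+ 4 * sqnorm (separated_wave k a b).
Proof.
move=> a0; rewrite (separated_wave_sqnorm _ _ a0) mulr_sumr.
have sV := smooth_separated_wave k a b; have HV := H2_smooth oO bO sV.
apply: eq_bigr => i _; rewrite (bigD1 i)//= big1 ?addr0 => [|j ji].
  have E := weak_partial_sqnorm oO bO (isT : (size [:: i; i] <= 2)%N) HV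
    (weak_partials_smooth oO bO [:: i; i] sV).
  rewrite [LHS]E [iter_partial _ _](partial2_separated_wave k a b i i) eqxx.
  rewrite (sqnormZ mO _ (wave_L2 _ _ _ _)); congr (_ * _); ring.
have E := weak_partial_sqnorm oO bO (isT : (size [:: i; j] <= 2)%N) HV
    (weak_partials_smooth oO bO [:: i; j] sV).
rewrite [LHS]E [iter_partial _ _](partial2_separated_wave k a b i j) (negPf ji).
by rewrite /L2_sqnorm dot0l.
Qed.

(** Each wave of x_i alone satisfies d_ii f = - k^2 f, so two integrations by parts
per coordinate turn the Hessian form into k^4 times the scalar product. *)
Lemma separated_wave_weak_eq k a b phi : test phi ->
  \sum_(i < d) \sum_(j < d) dot ('D_(e_ j) ('D_(e_ i) phi))
     ('D_(e_ j) ('D_(e_ i) (separated_wave k a b))) = k ^+ 4 * dot phi (separated_wave k a b).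
Proof.
move=> tphi; have Lphi := test_L2 oO bO tphi.
have Lw l : L2 (wave k l (a l) (b l)) := wave_L2 k l (a l) (b l).
rewrite separated_waveE [dot phi _]dotC (dot_suml mO _ Lw Lphi) mulr_sumr.
rewrite -separated_waveE; apply: eq_bigr => i _.
rewrite (bigD1 i)//= big1 ?addr0 => [|j ji]; last first.
  have E := partial2_separated_wave k a b i j; rewrite (negPf ji) in E.
  exact: (etrans (congr1 (dot _) E) (dot0r mO _)).
have LD := test_L2 oO bO (test_partial i (test_partial i tphi)).
have E := partial2_separated_wave k a b i i; rewrite eqxx in E.
rewrite [LHS](congr1 (dot _) E) (dotZr mO _ (Lw i) LD).
have E1 := smooth_dot_iter_partial [:: i; i] oO (smooth_wave k i (a i) (b i)) tphi.
have E2 := congr1 (dot^~ phi) (partial2_wave k i (a i) (b i)).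
rewrite [X in _ * X](etrans (dotC _ _ _) E1) [X in _ * (_ * X)]E2.
rewrite (dotZl mO _ (Lw i) Lphi) /=; ring.
Qed.

Lemma approximable_wave_hess k a b u : H2 u -> test_approximable Omega u ->
  hess u (separated_wave k a b) = k ^+ 4 * dot u (separated_wave k a b).
Proof.
move=> Hu Au; apply: (approximable_hess oO bO Hu Au (smooth_separated_wave k a b)).
by move=> phi; exact: separated_wave_weak_eq.
Qed.

(** If V is null, so are d_l V / k and d_ll V / k^2, whose squares add up to the constant
a_l^2 + b_l^2. That L^2 is not trivial says that Omega is not a null set. *)
Lemma separated_wave_null k a b : k != 0 -> (exists2 u, L2 u & sqnorm u != 0) ->
  sqnorm (separated_wave k a b) = 0 -> forall l, a l = 0 /\ b l = 0.
Proof.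
move=> k0 [u Lu u0] V0 l.
have sV := smooth_separated_wave k a b; have HV := H2_smooth oO bO sV.
have LV := H2_L2 HV; have P (r : seq 'I_d) := weak_partials_smooth oO bO r sV.
have null (r : seq 'I_d) : sqnorm (iter_partial (rev r) (separated_wave k a b)) = 0.
  have := weak_partials_unique oO bO (P r) (weak_partials_null oO bO r LV V0).
  by rewrite subr0.
have n1 : sqnorm (wave k l (k * b l) (- (k * a l))) = 0.
  by have := null [:: l]; rewrite [iter_partial _ _](partial_separated_wave k a b l).
have n2 : sqnorm (wave k l (a l) (b l)) = 0.
  have := null [:: l; l]; rewrite [iter_partial _ _](partial2_separated_wave k a b l l) eqxx.
  rewrite (sqnormZ mO _ (wave_L2 _ _ _ _)) => /eqP.
  by rewrite mulf_eq0 sqrf_eq0 oppr_eq0 sqrf_eq0 (negPf k0)/= => /eqP.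
have : (a l ^+ 2 + b l ^+ 2) * fine (mu Omega) = 0.
  rewrite -Rintegral_cst//.
  transitivity (k ^- 2 * sqnorm (wave k l (k * b l) (- (k * a l))) +
    sqnorm (wave k l (a l) (b l))); last by rewrite n1 n2 mulr0 addr0.
  have L1 := wave_L2 k l (k * b l) (- (k * a l)); have i1 := L2_mul_integrable mO L1 L1.
  have i2 := L2_mul_integrable mO (wave_L2 k l (a l) (b l)) (wave_L2 k l (a l) (b l)).
  rewrite /L2_sqnorm /L2_dot -RintegralZl// -RintegralD//; last first.
    exact: (integrableZl mO (k ^- 2) i1).
  apply: eq_Rintegral => x _; rewrite /wave.
  have := cos2Dsin2 (k * x ord0 l); move: (cos _) (sin _) => C S CS.
  rewrite -[LHS]mulr1 -CS; field; exact: k0.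
move=> /eqP; rewrite mulf_eq0 paddr_eq0 ?sqr_ge0// !sqrf_eq0.
case/orP => [/andP[/eqP ? /eqP ?]//|/eqP O0]; exfalso; move/eqP: u0; apply.
have muO : mu Omega = 0%E.
  rewrite -[LHS]fineK ?O0// ge0_fin_numE//.
  have [M _ OM] := bounded_sub_box bO.
  apply: le_lt_trans (lebesgue_rV_closed_box (fun=> - M) (fun=> M)).
  by apply: le_measure => //; rewrite inE//; exact: measurable_closed_box.
rewrite /L2_sqnorm /L2_dot /Rintegral null_set_integral//.
by apply/measurable_EFinP; apply: measurable_funM; exact: Lu.1.
Qed.

End wave_energy.

(** * Spectral bounds and the comparison of eigenvalues *)

Section spectral_bounds.
Context (R : realType) (d : nat) (Omega : set 'rV[R]_d).
Hypotheses (oO : open Omega) (bO : bounded_set Omega).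
Implicit Types (u v w : 'rV[R]_d -> R) (e : nat -> 'rV[R]_d -> R) (lam : nat -> R).

Local Notation dot := (L2_dot Omega).
Local Notation sqnorm := (L2_sqnorm Omega).
Local Notation L2 := (L2 Omega).
Local Notation H2 := (H2 Omega).
Local Notation hess := (hessian_form Omega).

Let mO : measurable Omega := open_measurable_rV oO.

Section orthonormal_combination.
Variables (e : nat -> 'rV[R]_d -> R) (n : nat) (c : nat -> R).
Hypotheses (He : forall k, H2 (e k)) (e_on : forall m k, dot (e m) (e k) = (m == k)%:R).

Let S := \sum_(k < n) c k *: e k.

Lemma combination_H2 : H2 S.
Proof. by apply: (H2_sum oO bO) => k; exact: (H2Z oO bO). Qed.

Lemma dot_combinationl w : L2 w -> dot S w = \sum_(k < n) c k * dot (e k) w.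
Proof.
move=> Lw; have Lce (k : 'I_n) : L2 (c k *: e k) := L2Z mO (c k) (H2_L2 (He k)).
rewrite (dot_suml mO _ Lce Lw); apply: eq_bigr => k _.
exact: (dotZl mO _ (H2_L2 (He k)) Lw).
Qed.

Lemma hess_combinationl w : H2 w -> hess S w = \sum_(k < n) c k * hess (e k) w.
Proof.
move=> Hw; have Hce (k : 'I_n) : H2 (c k *: e k) := H2Z oO bO (c k) (He k).
rewrite (hess_suml oO bO _ Hce Hw); apply: eq_bigr => k _.
exact: (hessZl oO bO _ (He k) Hw).
Qed.

Lemma dot_combination_basis (k : 'I_n) : dot S (e k) = c k.
Proof.
rewrite (dot_combinationl (H2_L2 (He k))) (bigD1 k)//= big1 ?addr0 => [|j jk].
  by rewrite e_on eqxx mulr1.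
by rewrite e_on (negPf (jk : (j : nat) != k)) mulr0.
Qed.

Lemma sqnorm_combination : sqnorm S = \sum_(k < n) c k ^+ 2.
Proof.
rewrite /L2_sqnorm (dot_combinationl (H2_L2 combination_H2)); apply: eq_bigr => k _.
by rewrite dotC dot_combination_basis expr2.
Qed.

Lemma hess_combination lam : (forall m k, hess (e m) (e k) = lam m * (m == k)%:R) ->
  hess S S = \sum_(k < n) lam k * c k ^+ 2.
Proof.
move=> he; rewrite (hess_combinationl combination_H2); apply: eq_bigr => k _.
rewrite hessC (hess_combinationl (He k)) (bigD1 k)//= big1 ?addr0 => [|j jk].
  by rewrite he eqxx mulr1; ring.
by rewrite he (negPf (jk : (j : nat) != k)) !mulr0.
Qed.

End orthonormal_combination.

(** Half of the min-max principle. Bessel's inequality for the Hessian form, obtained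
from h[w - S] >= 0 for the partial sums S of the expansion of w, bounds h[w] from
below by the sum of the mu_n (w, e_n)^2, and completeness of the e_n gives
|w|^2 as the sum of the (w, e_n)^2. *)
Lemma neumann_lower_bound mu e m w :
  nondecreasing_seq mu ->
  (forall n, neumann_biharmonic Omega (e n) (mu n *: e n)) ->
  (forall m n, dot (e m) (e n) = (m == n)%:R) ->
  (forall u, L2 u ->
     sqnorm (u - \sum_(k < n) dot u (e k) *: e k) @[n --> \oo] --> (0 : R)) ->
  H2 w -> (forall n, (n < m)%N -> dot w (e n) = 0) ->
  mu m * sqnorm w <= hess w w.
Proof.
have alg (h B : R) : 0 <= h + -1 * B + (-1 * B + -1 * (-1 * B)) -> B <= h by lra.
move=> mu_nd Te e_on e_complete Hw w_orth.
have He n : H2 (e n) by case: (Te n).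
have Le n := H2_L2 (He n); have Lw := H2_L2 Hw.
have hew n v : H2 v -> hess (e n) v = mu n * dot (e n) v.
  by move=> Hv; have [_ _ /(_ v Hv) ->] := Te n; rewrite (dotZl mO _ (Le n) (H2_L2 Hv)).
have he k n : hess (e k) (e n) = mu k * (k == n)%:R by rewrite hew// e_on.
pose c n := dot w (e n).
pose S n := \sum_(k < n) c k *: e k.
have HS n : H2 (S n) by exact: (combination_H2 n c He).
have bound n : mu m * (sqnorm w - sqnorm (w - S n)) <= hess w w.
  have dS : dot w (S n) = \sum_(k < n) c k ^+ 2.
    rewrite dotC (dot_combinationl n c He Lw); apply: eq_bigr => k _.
    by rewrite dotC expr2.
  have hS : hess (S n) w = \sum_(k < n) mu k * c k ^+ 2.
    rewrite (hess_combinationl n c He Hw); apply: eq_bigr => k _.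
    by rewrite (hew _ _ Hw) [dot _ w]dotC -/(c k); ring.
  have hSS := hess_combination n c He he; have sS := sqnorm_combination n c He e_on.
  rewrite -/(S n) in hSS sS.
  have -> : sqnorm w - sqnorm (w - S n) = \sum_(k < n) c k ^+ 2.
    by rewrite (sqnormB mO Lw (H2_L2 (HS n))) dS sS; ring.
  have : \sum_(k < n) mu k * c k ^+ 2 <= hess w w.
    have Hm := H2Z oO bO (-1) (HS n).
    have Hwm := H2D oO bO Hw Hm.
    have := hess_ge0 Omega (w + -1 *: S n).
    rewrite (hessDl oO bO Hw Hm Hwm) (hessDr oO bO Hw Hm Hw) (hessDr oO bO Hw Hm Hm).
    rewrite !(hessZl oO bO _ (HS n)) ?(hessZr oO bO _ (HS n))// (hessC _ w) hS hSS.
    exact: alg.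
  apply: le_trans; rewrite mulr_sumr; apply: ler_sum => k _.
  have [km|mk] := ltnP k m; first by rewrite /c w_orth// expr0n/= !mulr0.
  by rewrite ler_wpM2r ?sqr_ge0// mu_nd.
have lim : mu m * (sqnorm w - sqnorm (w - S n)) @[n --> \oo] --> mu m * (sqnorm w - 0).
  apply: cvgM; first exact: cvg_cst.
  by apply: cvgB; [exact: cvg_cst|exact: e_complete].
rewrite subr0 in lim; rewrite -(cvg_lim _ lim)//.
by apply: limr_le; [exact: cvgP lim|exact: nearW].
Qed.

(** Otherwise the second derivatives of u would be null, hence u as well. *)
Lemma dirichlet_eigenvalue_gt0 (i : 'I_d) (lam : R) u :
  dirichlet_biharmonic Omega u (lam *: u) -> sqnorm u = 1 -> 0 < lam.
Proof.
move=> [H20u _ /(_ u H20u)]; have Hu := H20u.1.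
rewrite (dotZl mO _ (H2_L2 Hu) (H2_L2 Hu)) -/(L2_sqnorm Omega u) => hu u1.
rewrite u1 mulr1 in hu; rewrite -hu lt_neqAle hess_ge0 andbT.
apply/eqP => h0; have : sqnorm u = 0.
  apply: (approximable_null oO bO (i := i) (j := i) Hu (H20_approximable oO bO H20u)).
  apply/eqP; rewrite eq_le sqnorm_ge0 andbT [leRHS]h0.
  exact: le_weak_partial_hess.
by rewrite u1 => /eqP; rewrite oner_eq0.
Qed.

End spectral_bounds.

Lemma underdetermined_system (K : fieldType) (m n : nat) (A : 'M[K]_(m, n)) :
  (n < m)%N -> exists2 x : 'rV[K]_m, x != 0 & x *m A = 0.
Proof.
move=> nm; have : kermx A != 0.
  rewrite kermx_eq0 /row_free; apply/eqP => rA.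
  by have := rank_leq_col A; rewrite rA leqNgt nm.
by move=> /rowV0Pn[x /sub_kermxP xA x0]; exists x.
Qed.

Theorem theorem1p2 (R : realType) (d : nat) (Omega : set 'rV[R]_d)
    (lambda mu : nat -> R) :
  (2 <= d)%N ->
  bounded_lipschitz_domain Omega ->
  (forall l : 'I_d, (0 < l)%N -> reflection l @` Omega = Omega) ->
  eigenvalue_sequence Omega (dirichlet_biharmonic Omega) lambda ->
  eigenvalue_sequence Omega (neumann_biharmonic Omega) mu ->
  forall k : nat, mu (k + d + 1)%N <= lambda k.
Proof.
have alg (h l x y z : R) : h <= l * x -> h + l * y + (l * y + l * z) <= l * (x + 2 * y + z).
  by move=> hl; lra.
move=> d2 [oO _ _ bO _] symO [lam_nd _ [e [Te e_on _]]] [mu_nd _ [f [Tf f_on f_complete]]] k.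
have mO := open_measurable_rV oO.
pose i0 : 'I_d := Ordinal (ltnW d2); pose i1 : 'I_d := Ordinal d2.
have He n : H2 Omega (e n) by case: (Te n) => -[].
have Ae n : test_approximable Omega (e n) by case: (Te n) => /(H20_approximable oO bO).
have Hf n : H2 Omega (f n) by case: (Tf n).
have Le n := H2_L2 (He n); have Lf n := H2_L2 (Hf n).
have lam_gt0 : 0 < lambda k.
  by apply: (dirichlet_eigenvalue_gt0 oO bO i0 (Te k)); rewrite /L2_sqnorm e_on eqxx.
pose kap := Num.sqrt (Num.sqrt (lambda k)).
have kap4 : kap ^+ 4 = lambda k.
  by rewrite (exprM kap 2 2) sqr_sqrtr ?sqrtr_ge0// sqr_sqrtr// ltW.
have kap0 : kap != 0 by apply: contraTneq lam_gt0 => kap0; rewrite -kap4 kap0 expr0n/= ltxx.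
pose coswave := wave kap i0 1 0; pose sinwave (l : 'I_d) := wave kap l 0 1.
have Lcos : L2 Omega coswave by exact: wave_L2.
have Lsin l : L2 Omega (sinwave l) by exact: wave_L2.
(* The left kernel of A consists of the coefficients of the trial functions that are
orthogonal to the first k + d + 1 Neumann eigenfunctions. *)
pose A : 'M[R]_(k.+1 + (1 + d), k + d + 1) := col_mx
  (\matrix_(n, m) L2_dot Omega (e n) (f m))
  (col_mx (\row_m L2_dot Omega coswave (f m)) (\matrix_(l, m) L2_dot Omega (sinwave l) (f m))).
have [|X X0 XA] := underdetermined_system A; first by rewrite addSn ltnS addnA addnAC.
(* Extended by 0 beyond k, as sums of e_n are indexed by natural numbers. *)
pose al n : R := if insub n is Some j then lsubmx X ord0 j else 0.
have alE (n : 'I_k.+1) : al n = lsubmx X ord0 n by rewrite /al valK.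
have XE : X = row_mx (lsubmx X) (row_mx (lsubmx (rsubmx X)) (rsubmx (rsubmx X))).
  by rewrite !hsubmxK.
pose c0 := lsubmx (rsubmx X) ord0 ord0.
pose b l := rsubmx (rsubmx X) ord0 l.
pose a (l : 'I_d) := if (l : nat) == 0%N then c0 else 0.
have a0 (l : 'I_d) : (0 < l)%N -> a l = 0 by rewrite /a; case: (l : nat).
pose u := \sum_(n < k.+1) al n *: e n.
pose V := separated_wave kap a b.
have VE : V = c0 *: coswave + \sum_(l < d) b l *: sinwave l.
  apply/funext => x; rewrite /V /separated_wave.
  transitivity (\sum_(l < d) (a l * wave kap l 1 0 x + b l * wave kap l 0 1 x)).
    by apply: eq_bigr => l _; rewrite /wave; ring.
  rewrite big_split (bigD1 i0)//= [X in _ + X + _]big1 ?addr0 => [|l li0]; last first.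
    rewrite a0 ?mul0r// lt0n; apply: contra li0 => /eqP l0; exact/eqP/val_inj.
  transitivity (c0 * coswave x + (\sum_(l < d) b l *: sinwave l) x); last by [].
  by rewrite fct_sumE.
have Hu : H2 Omega u by exact: (combination_H2 oO bO).
have Lu := H2_L2 Hu.
have Au : test_approximable Omega u.
  apply: (approximable_sum oO bO) => n; first exact: (L2Z mO).
  exact: (approximableZ oO bO).
have sV : smooth V by exact: smooth_separated_wave.
have HV := H2_smooth oO bO sV; have LV := H2_L2 HV.
have Hw := H2D oO bO Hu HV; have Lw := H2_L2 Hw.
have w_orth n : (n < k + d + 1)%N -> L2_dot Omega (u + V) (f n) = 0.
  move=> nk; pose m : 'I_(k + d + 1) := Ordinal nk.
  have := congr1 (fun B : 'rV_(k + d + 1) => B ord0 m) XA.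
  rewrite {1}XE /A !mul_row_col !mxE => <-.
  have Lbs (l : 'I_d) : L2 Omega (b l *: sinwave l) := L2Z mO (b l) (Lsin l).
  rewrite (dotDl mO Lu LV (Lf n)) VE.
  rewrite (dotDl mO (L2Z mO c0 Lcos) (L2_sum mO _ Lbs) (Lf n)) (dotZl mO _ Lcos (Lf n)).
  rewrite (dot_suml mO _ Lbs (Lf n)) (dot_combinationl oO _ _ He (Lf n)).
  congr (_ + (_ + _)).
  - by apply: eq_bigr => j _; rewrite alE !mxE.
  - by rewrite big_ord1; congr (_ * _); rewrite mxE.
  - by apply: eq_bigr => l _; rewrite (dotZl mO _ (Lsin l) (Lf n)); congr (_ * _); rewrite mxE.
have lower := neumann_lower_bound oO bO mu_nd Tf f_on f_complete Hw w_orth.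
have hee m n : hessian_form Omega (e m) (e n) = lambda m * (m == n)%:R.
  have [_ _ /(_ (e n))] := Te m; case: (Te n) => H20n _ _ /(_ H20n) ->.
  by rewrite (dotZl mO _ (Le m) (Le n)) e_on.
have huu : hessian_form Omega u u <= lambda k * L2_sqnorm Omega u.
  rewrite (hess_combination oO bO _ _ He hee) (sqnorm_combination oO bO _ _ He e_on).
  rewrite mulr_sumr; apply: ler_sum => n _; rewrite ler_wpM2r ?sqr_ge0// lam_nd//.
  by rewrite -ltnS.
have upper : hessian_form Omega (u + V) (u + V) <= lambda k * L2_sqnorm Omega (u + V).
  rewrite (hessDl oO bO Hu HV Hw) (hessDr oO bO Hu HV Hu) (hessDr oO bO Hu HV HV).
  rewrite (hessC _ V u) (approximable_wave_hess oO bO kap a b Hu Au).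
  rewrite (separated_wave_hess oO bO symO kap b a0) kap4 -/V (sqnormD mO Lu LV).
  exact: alg.
have := sqnorm_ge0 Omega (u + V); rewrite le_eqVlt => /predU1P[w0|w_gt0]; last first.
  by rewrite -(ler_pM2r w_gt0) (le_trans lower).
(* Here w = u + V is null and the trial functions are linearly independent: V has no
mixed second derivative, so u is null by Poincare's inequality, then V is. *)
exfalso; move/eqP: X0; apply.
have s2 : (size [:: i0; i1] <= 2)%N by [].
have u_null : L2_sqnorm Omega u = 0.
  apply: (approximable_null oO bO (i := i0) (j := i1) Hu Au).
  have Pw := weak_partials_null oO bO [:: i0; i1] Lw (esym w0).
  have PV := weak_partials_smooth oO bO [:: i0; i1] sV.
  have := weak_partialsB oO bO Lw LV Pw PV; rewrite addrK => Pu.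
  rewrite (weak_partial_sqnorm oO bO s2 Hu Pu).
  have E := partial2_separated_wave kap a b i0 i1; rewrite /= in E.
  rewrite [iter_partial _ _]E subr0 /L2_sqnorm.
  by rewrite dot0l.
have al0 (n : 'I_k.+1) : al n = 0.
  rewrite -(dot_combination_basis oO _ He e_on n).
  exact: (null_dot mO Lu (Le n) u_null).
have V_null : L2_sqnorm Omega V = 0.
  have := sqnormB mO Lw Lu; rewrite [u + V]addrC addrK => ->.
  by rewrite u_null [V + u]addrC -w0 (null_dotr mO Lu Lw u_null); ring.
have nontrivial : exists2 v, L2 Omega v & L2_sqnorm Omega v != 0.
  by exists (e 0%N); [exact: Le|rewrite /L2_sqnorm e_on oner_eq0].
have ab0 := separated_wave_null oO bO kap0 nontrivial V_null.
rewrite XE (_ : lsubmx X = 0); last by apply/rowP => n; rewrite -alE al0 mxE.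
rewrite (_ : lsubmx (rsubmx X) = 0); last first.
  by apply/rowP => j; rewrite ord1 [RHS]mxE; have [<- _] := ab0 i0.
rewrite (_ : rsubmx (rsubmx X) = 0) ?row_mx0//.
by apply/rowP => l; rewrite [RHS]mxE; have [_ <-] := ab0 l.
Qed.
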